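(* Consider an $\mathbb{R}^d$-valued random variable $X$ whose components have no point mass, with the natural (componentwise) partial order $\ge$ on $\mathbb{R}^d$. If the components of $X$ are independent, then the partial quantile indices satisfy, for $\tau\in(0,1)$, $$P(\tau_X\le\tau)=P\left(\sum_{j=1}^dZ_j\le\log\left(\frac{\tau}{1-\tau}\right)\right),$$ where $Z_j$ are independent logistic random variables with zero mean and variance $\pi^2/3$. In particular, $P(\tau_X\ge1/2)=1/2$, and for any positive number $C$, $$P(|\tau_X-0.5|\le0.5-Cd^{-1/2})\le1/C.$$
   Context: The partial order is $a\succcurlyeq b$ iff $a_j\ge b_j$ for all $j$. $\mathcal{C}(x)=\{y:y\succcurlyeq x\text{ or }y\preccurlyeq x\}$. The partial quantile index of a point $x\in\mathbb{R}^d$ is $\tau_x=P(X\preccurlyeq x\mid X\in\mathcal{C}(x))$, and $\tau_X$ is the random variable obtained by evaluating $x\mapsto\tau_x$ at $x=X$. *)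

(* Defs.v *)
From HB Require Import structures.
From mathcomp Require Import all_boot all_order all_algebra.
From mathcomp Require Import all_classical all_reals all_analysis.

Set Implicit Arguments.
Unset Strict Implicit.
Unset Printing Implicit Defensive.

Import Order.TTheory GRing.Theory Num.Theory.
Import numFieldNormedType.Exports.

Local Open Scope classical_set_scope.
Local Open Scope ring_scope.

(* R^d is rendered as [d.-tuple R], which carries the product (hence Borel)
   sigma-algebra, so that [{RV P >-> d.-tuple R}] is the type of R^d-valued
   random variables. *)

Definition succeq (R : realType) (d : nat) (a b : d.-tuple R) : Prop :=
  forall j : 'I_d, tnth b j <= tnth a j.

Definition comparable_set (R : realType) (d : nat) (x : d.-tuple R)
    : set (d.-tuple R) :=
  [set y | succeq y x \/ succeq x y].

(* Equals 0 when P B = 0, since x / 0 = 0. *)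
Definition cond_prob (disp : measure_display) (T : measurableType disp)
    (R : realType) (P : probability T R) (A B : set T) : R :=
  fine (P (A `&` B)) / fine (P B).

Definition partial_quantile_index (disp : measure_display)
    (T : measurableType disp) (R : realType) (P : probability T R)
    (d : nat) (X : {RV P >-> d.-tuple R}) (x : d.-tuple R) : R :=
  cond_prob P [set t | succeq x (X t)] (X @^-1` comparable_set x).

(* Mutual independence: the product rule for every subfamily. *)
Definition independent_family (disp : measure_display)
    (T : measurableType disp) (R : realType) (P : probability T R)
    (I : finType) (Y : I -> T -> R) : Prop :=
  forall (J : {set I}) (A : I -> set R), (forall i, measurable (A i)) ->
    P (\bigcap_(i in [set` J]) (Y i @^-1` A i)) =
    (\prod_(i in J) P (Y i @^-1` A i))%E.

(* The logistic location-scale family, specified by its cumulative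
   distribution function. *)
Definition logistic_rv (disp : measure_display)
    (T : measurableType disp) (R : realType) (P : probability T R)
    (Z : {RV P >-> R}) : Prop :=
  exists mu s : R, 0 < s /\
    forall x : R, cdf Z x = ((1 + expR (- ((x - mu) / s)))^-1)%:E.

(* Main.v *)
Require Import Defs.
From HB Require Import structures.
From mathcomp Require Import all_boot all_order all_algebra.
From mathcomp Require Import all_classical all_reals all_analysis.
From mathcomp Require Import measurable_realfun zify ring lra.

(* Since the components are independent and atomless, the index of [x] is
   A / (A + B) with A = \prod_j F_j(x_j) and B = \prod_j (1 - F_j(x_j)). Hence
   its log-odds at X is the sum of the terms ln F_j(X_j) - ln (1 - F_j(X_j)),
   which are independent, and standard logistic because each F_j(X_j) is
   uniform. A logistic variable with mean 0 and variance pi^2/3 is standard: its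
   second moment is the series 4 \sum_k (-1)^(k+1) / k^2 = pi^2/3. The sum of
   the log-odds is symmetric and atomless, whence the median. For the last bound,
   the event is |S| <= ln (1/c - 1) with c = C d^(-1/2). A standard logistic
   variable exceeds ln 3 in modulus with probability 1/2, so a Littlewood-Offord
   argument compares S with a lazy walk: each interval of length 2 ln 3 has
   probability at most 'C(2d+1, d+1) / 4^d <= 2 / sqrt (3d+4). *)

Set Implicit Arguments.
Unset Strict Implicit.
Unset Printing Implicit Defensive.

Import Order.TTheory GRing.Theory Num.Theory.
Import numFieldNormedType.Exports.

Local Open Scope classical_set_scope.
Local Open Scope ring_scope.

(** * The alternating sum of inverse squares *)

(** The last bound has to hold in every dimension with the constant 1, so asymptotic normality is of
    no use and the concentration estimate must be explicit. It has room to spare: about ln (1/c) /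
    ln 3 windows of length 2 ln 3 cover the event, each has mass at most 2 / sqrt (3d), and a
    logarithm of 1/c stays well below 1/c. The length is dictated by the median: conditioning on one
    summand then splits into two events of mass exactly 1/2, as for the lazy walk. The estimate for
    a single window does not carry an induction, because averaging over the sign of a large summand
    turns r windows into r + 1 and r - 1; the induction therefore runs over families of separated
    windows. The variance of the standard law is needed because the variables of the theorem come
    with unknown location and scale, and the scale can be read off the variance only once that of
    the standard law is known. All identities between the index and the log-odds hold off the null
    event where some F_j is 0 or 1. *)

Section basel.
Variable R : realType.
Implicit Types (x y : R) (n : nat).

Lemma sin_le x : 0 <= x -> sin x <= x.
Proof.
rewrite le_eqVlt => /predU1P[<-|x0]; first by rewrite sin0.
have dsin z : z \in `]0, x[ -> is_derive z 1 (sin : R -> R) (cos z).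
  by move=> _; exact: is_derive_sin.
have [|c _] := MVT x0 dsin.
  by apply: continuous_subspaceT => z; exact: continuous_sin.
by rewrite sin0 !subr0 => ->; rewrite ger_pMl// cos_le1.
Qed.

Lemma le_tan x : 0 <= x < pi / 2 -> x <= tan x.
Proof.
case/andP; rewrite le_eqVlt => /predU1P[<-|x0 xpi]; first by rewrite tan0.
have cos0 z : 0 <= z <= x -> 0 < cos z.
  move=> /andP[z0 zx]; apply: cos_gt0_pihalf; apply/andP; split; last lra.
  by rewrite (lt_le_trans _ z0)// oppr_lt0 divr_gt0 ?pi_gt0.
have dtan z : z \in `]0, x[ -> is_derive z 1 (tan : R -> R) ((cos z)^-2).
  rewrite in_itv/= => /andP[z0 zx]; apply: is_derive_tan.
  by rewrite gt_eqF// cos0// !ltW.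
have [|c] := MVT x0 dtan.
  apply: derivable_within_continuous => z; rewrite in_itv/= => zx.
  by apply: derivable_tan; rewrite gt_eqF// cos0.
rewrite in_itv/= => /andP[c0 cx]; rewrite tan0 !subr0 => ->.
have cc : 0 < cos c by rewrite cos0// !ltW.
rewrite ler_peMl//; first exact: ltW.
by rewrite invf_ge1 ?exprn_gt0// exprn_ile1 ?cos_le1// ltW.
Qed.

(** Square and invert [sin x <= x <= tan x]; the lower bound is the squared cotangent. *)
Lemma sinV2_bounds x : 0 < x < pi / 2 ->
  (sin x ^+ 2)^-1 - 1 <= (x ^+ 2)^-1 <= (sin x ^+ 2)^-1.
Proof.
move=> /andP[x0 xpi]; have s0 : 0 < sin x by rewrite sin_gt0_pihalf// x0.
have c0 : 0 < cos x.
  by rewrite cos_gt0_pihalf// xpi andbT (lt_trans _ x0)// oppr_lt0 divr_gt0 ?pi_gt0.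
have sx : sin x <= x by rewrite sin_le// ltW.
have xt : x * cos x <= sin x by rewrite -ler_pdivlMr// le_tan// xpi ltW.
apply/andP; split; last first.
  by rewrite lef_pV2 ?posrE ?exprn_gt0// lerXn2r// nnegrE ltW.
have -> : (sin x ^+ 2)^-1 - 1 = (cos x / sin x) ^+ 2.
  rewrite expr_div_n cos2sin2; field.
  by rewrite gt_eqF.
rewrite -exprVn; apply: lerXn2r;
  rewrite ?nnegrE ?invr_ge0 ?divr_ge0 ?(ltW x0) ?(ltW s0) ?(ltW c0)//.
by rewrite ler_pdivrMr// ler_pdivlMl.
Qed.

(* Iterating [4 / sin(y)^2 = 1 / sin(y/2)^2 + 1 / cos(y/2)^2], where
   [cos(y/2) = sin(y/2 + pi/2)]. *)
Lemma sum_sinV2 n x :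
  (forall k : nat, (k < 2 ^ n)%N -> sin ((x + k%:R * pi) / 2 ^+ n) != 0) ->
  \sum_(k < 2 ^ n) (sin ((x + k%:R * pi) / 2 ^+ n) ^+ 2)^-1
  = 4 ^+ n / sin x ^+ 2.
Proof.
elim: n => [|n IH] sin0.
  by rewrite expn0 big_ord1 expr0 divr1 mul0r addr0 mul1r.
have E (k : nat) : (x + k%:R * pi) / 2 ^+ n = ((x + k%:R * pi) / 2 ^+ n.+1) *+ 2.
  by rewrite exprS; field; rewrite expf_neq0.
have E2 (k : nat) : (x + (2 ^ n + k)%N%:R * pi) / 2 ^+ n.+1
    = (x + k%:R * pi) / 2 ^+ n.+1 + pi / 2.
  by rewrite natrD natrX exprS; field; rewrite expf_neq0.
have s0 k : (k < 2 ^ n)%N -> sin ((x + k%:R * pi) / 2 ^+ n.+1) != 0.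
  by move=> kn; apply: sin0; rewrite (leq_trans kn)// leq_exp2l.
have c0 k : (k < 2 ^ n)%N -> cos ((x + k%:R * pi) / 2 ^+ n.+1) != 0.
  by move=> kn; rewrite -sinDpihalf -E2 sin0// expnS mul2n -addnn ltn_add2l.
rewrite [in LHS]expnS mul2n -addnn big_split_ord/= -big_split/=.
rewrite [in RHS]exprS -mulrA -IH; last first.
  move=> k kn; rewrite E sin_mulr2n -mulr_natr !mulf_neq0//.
  - exact: c0.
  - exact: s0.
rewrite mulr_sumr; apply: eq_bigr => -[k /= kn] _.
rewrite E2 sinDpihalf E sin_mulr2n.
set y := (x + _) / _.
have ys : sin y != 0 by exact: s0.
have yc : cos y != 0 by exact: c0.
have := cos2Dsin2 y.
set s := sin y in ys *; set c := cos y in yc * => cs1.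
rewrite -mulr_natr -[LHS]mulr1.
rewrite -[X in _ * X = _]cs1.
apply/eqP; rewrite -subr_eq0; apply/eqP.
rewrite (_ : _ - _ = (c ^+ 2 + s ^+ 2) * ((c ^+ 2 + s ^+ 2) - 1) / (c ^+ 2 * s ^+ 2)
   + ((c ^+ 2 + s ^+ 2) - 1)  / (c ^+ 2 * s ^+ 2)); last first.
  by field; rewrite ys yc.
by rewrite cs1 subrr !(mulr0,mul0r) addr0.
Qed.

(** Case [x = pi / 2] of [sum_sinV2], at [n.+1]: the angles are the odd multiples of pi / 2^(n+2)
    below pi, and y -> pi - y matches the upper half with the lower one, which leaves half of
    4^(n+1). *)
Lemma sum_odd_sinV2 n :
  \sum_(k < 2 ^ n) (sin (((2 * k).+1%:R / (4 * 2 ^+ n)) * pi : R) ^+ 2)^-1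
  = 2 * 4 ^+ n.
Proof.
pose f (k : nat) : R := (sin ((pi / 2 + k%:R * pi) / 2 ^+ n.+1) ^+ 2)^-1.
have fE (k : nat) : (2 * k).+1%:R / (4 * 2 ^+ n) * pi =
    (pi / 2 + k%:R * pi) / 2 ^+ n.+1 :> R.
  by rewrite -addn1 natrD natrM exprS; field; rewrite expf_neq0.
have frev k : (k < 2 ^ n)%N -> f (2 ^ n + (2 ^ n - k.+1))%N = f k.
  move=> kn; rewrite /f; suff -> : (pi / 2 + (2 ^ n + (2 ^ n - k.+1))%N%:R * pi) / 2 ^+ n.+1
    = - ((pi / 2 + k%:R * pi) / 2 ^+ n.+1) + pi :> R.
    by rewrite sinDpi sinN opprK.
  rewrite natrD natrB// -natr1 natrX exprS; field.
  by rewrite expf_neq0.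
have sumf : \sum_(k < 2 ^ n.+1) f k = 4 ^+ n.+1.
  rewrite sum_sinV2 ?sin_pihalf ?expr1n ?divr1// => k kn.
  rewrite gt_eqF// sin_gt0_pi//; apply/andP; split.
    by rewrite divr_gt0 ?exprn_gt0// ltr_wpDr ?mulr_ge0 ?divr_gt0 ?pi_ge0 ?pi_gt0.
  rewrite ltr_pdivrMr ?exprn_gt0//.
  have : k%:R + 1 <= 2 ^+ n.+1 :> R by rewrite natr1 -natrX ler_nat.
  have := pi_gt0 R; nra.
suff : 2 * \sum_(k < 2 ^ n) f k = 4 ^+ n.+1.
  by rewrite exprS => H; under eq_bigr do rewrite fE -/(f _); lra.
rewrite -sumf [in RHS]expnS mul2n -addnn big_split_ord/= mulrDl !mul1r; congr +%R.
rewrite [RHS](reindex_inj rev_ord_inj)/=; apply: eq_bigr => k _.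
by rewrite frev.
Qed.

(** Scaling by [a] makes the summands inverse squares of the angles of [sum_odd_sinV2]. By
    [sinV2_bounds] each of the 2^n terms is off by at most 1, and 2^n / a is the error term. *)
Lemma sum_odd_invsqr_bounds n :
  (pi ^+ 2 / 8 - pi ^+ 2 / (16 * 2 ^+ n) : R)
  <= \sum_(k < 2 ^ n) ((2 * k).+1%:R ^+ 2)^-1 <= (pi ^+ 2 / 8 : R).
Proof.
have n0 : 0 < 2 ^+ n :> R by rewrite exprn_gt0.
have p0 := pi_gt0 R.
pose a : R := (4 * 2 ^+ n / pi) ^+ 2.
have a0 : 0 < a by rewrite exprn_gt0// divr_gt0// mulr_gt0.
have E4 : 4 ^+ n = (2 ^+ n) ^+ 2 :> R by rewrite -exprM mulnC exprM; congr (_ ^+ _); ring.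
set O := \sum_(k < _) _.
have aO : a * O = \sum_(k < 2 ^ n) ((((2 * k).+1%:R / (4 * 2 ^+ n)) * pi : R) ^+ 2)^-1.
  rewrite mulr_sumr; apply: eq_bigr => k _; rewrite /a -!exprVn -exprMn.
  by congr (_ ^+ 2); rewrite invfM invf_div mulrAC.
have b (k : 'I_(2 ^ n)) : 0 < ((2 * k).+1%:R / (4 * 2 ^+ n)) * @pi R < pi / 2.
  apply/andP; split; first by rewrite mulr_gt0 ?divr_gt0 ?mulr_gt0.
  rewrite mulrAC ltr_pdivrMr ?mulr_gt0//.
  have : (2 * k).+1%:R < 2 * 2 ^+ n :> R.
    by rewrite -natrX -natrM ltr_nat -addn1 !mul2n -!addnn; have := ltn_ord k; lia.
  nra.
have : a * (pi ^+ 2 / 8 - pi ^+ 2 / (16 * 2 ^+ n)) <= a * O <= a * (pi ^+ 2 / 8).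
  have -> : a * (pi ^+ 2 / 8) = 2 * 4 ^+ n.
    rewrite E4 /a; move: (pi : R) p0 => p p0; field; exact: lt0r_neq0.
  have -> : a * (pi ^+ 2 / 8 - pi ^+ 2 / (16 * 2 ^+ n)) = 2 * 4 ^+ n - 2 ^+ n.
    rewrite E4 /a; move: (pi : R) p0 => p p0; field.
    by rewrite !lt0r_neq0.
  rewrite aO -sum_odd_sinV2; apply/andP; split; last first.
    by apply: ler_sum => k _; have /andP[] := sinV2_bounds (b k).
  rewrite [X in _ - X <= _](_ : _ = \sum_(k < 2 ^ n) (1 : R)); last first.
    by rewrite sumr_const card_ord natrX.
  rewrite -sumrB; apply: ler_sum => k _.
  by have /andP[] := sinV2_bounds (b k).
by rewrite !ler_pM2l.
Qed.

(** With [O] the odd and [H] the full sums of inverse squares, the partial sums are O - H / 4. The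
    bounds give the limit of [O] along powers of two, monotonicity gives it along all n, and [HD]
    then forces lim H = pi^2 / 6. *)
Lemma sum_alternating_invsqr :
  \sum_(k < n) (((2 * k).+1%:R ^+ 2)^-1 - ((2 * k).+2%:R ^+ 2)^-1 : R)
    @[n --> \oo] --> pi ^+ 2 / 12.
Proof.
pose O n : R := \sum_(k < n) ((2 * k).+1%:R ^+ 2)^-1.
pose H n : R := \sum_(k < n) (k.+1%:R ^+ 2)^-1.
have HD n : H (2 * n)%N = O n + H n / 4.
  elim: n => [|n IH]; first by rewrite /H /O !big_ord0 mul0r addr0.
  rewrite mulnS /H /O !big_ord_recr/= -/(H _) -/(O _) -/(H _) IH.
  rewrite -addrA mulrDl addrACA; congr (_ + _).
  have -> : (2 * n).+2 = (2 * n.+1)%N by rewrite mulnS.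
  have : n.+1%:R != 0 :> R by rewrite pnatr_eq0.
  by rewrite natrM; move: (n.+1%:R : R) => x x0; congr +%R; field.
have Ond : nondecreasing_seq O.
  by apply/nondecreasing_seqP => n; rewrite /O big_ord_recr/= lerDl.
have Hnd : nondecreasing_seq H.
  by apply/nondecreasing_seqP => n; rewrite /H big_ord_recr/= lerDl.
have Oub n : O n <= pi ^+ 2 / 8.
  apply: (@le_trans _ _ (O (2 ^ n)%N)); first by apply/Ond/ltnW/ltn_expl.
  by have /andP[] := sum_odd_invsqr_bounds n.
have Oexp : O (2 ^ n)%N @[n --> \oo] --> pi ^+ 2 / 8.
  apply: (@squeeze_cvgr _ _ _ _ (fun n => pi ^+ 2 / 8 - pi ^+ 2 / 16 * 2^-1 ^+ n)
     (cst (pi ^+ 2 / 8))).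
  - near=> n; have := sum_odd_invsqr_bounds n.
    by rewrite invfM mulrA exprVn.
  - rewrite -[X in _ --> X]subr0; apply: cvgB; first exact: cvg_cst.
    rewrite -[X in _ --> X](mulr0 (pi ^+ 2 / 16)); apply: cvgMr.
    by apply: cvg_expr; rewrite gtr0_norm ?invf_lt1// ltr1n.
  - exact: cvg_cst.
have Ocvg : O @ \oo --> pi ^+ 2 / 8.
  have OC : cvgn O by apply: nondecreasing_is_cvgn => //; exists (pi ^+ 2 / 8) => _ [n _ <-].
  have : O (2 ^ n)%N @[n --> \oo] --> limn O.
    apply: cvg_comp OC; apply/cvgnyPge => k; near=> n.
    by rewrite (leq_trans _ (ltnW (ltn_expl n _)))//; near: n; exact: nbhs_infty_ge.
  by move=> /(cvg_unique _ Oexp) ->.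
have HC : cvgn H.
  apply: nondecreasing_is_cvgn => //; exists (pi ^+ 2 / 6) => _ [n _ <-].
  have := Oub n; have := HD n; have : H n <= H (2 * n)%N by apply: Hnd; rewrite leq_pmull.
  lra.
have Hl : limn H = pi ^+ 2 / 6.
  have H2 : H (2 * n)%N @[n --> \oo] --> limn H.
    apply: cvg_comp HC; apply/cvgnyPge => k; near=> n.
    by rewrite (@leq_trans n) ?leq_pmull//; near: n; exact: nbhs_infty_ge.
  have : H (2 * n)%N @[n --> \oo] --> pi ^+ 2 / 8 + limn H / 4.
    by under eq_fun do rewrite HD; apply: cvgD => //; apply: cvgMl.
  move=> H3; have E : (limn H : R) = pi ^+ 2 / 8 + limn H / 4.
    exact: (cvg_unique (@Rhausdorff R) H2 H3).
  by move: E; move: (limn H : R) => l; lra.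
have -> : (fun n => \sum_(k < n) (((2 * k).+1%:R ^+ 2)^-1 - ((2 * k).+2%:R ^+ 2)^-1 : R))
   = (fun n => O n - H n / 4).
  apply/funext => n; rewrite sumrB; congr (_ - _).
  rewrite mulr_suml; apply: eq_bigr => k _.
  have -> : (2 * k).+2 = (2 * k.+1)%N by rewrite mulnS.
  have : k.+1%:R != 0 :> R by rewrite pnatr_eq0.
  by rewrite natrM; move: (k.+1%:R : R) => x x0; field.
rewrite (_ : pi ^+ 2 / 12 = pi ^+ 2 / 8 - pi ^+ 2 / 6 / 4); last by field.
apply: cvgB => //; apply: cvgMl; rewrite -Hl.
exact: HC.
Unshelve. all: end_near. Qed.

End basel.

(** * Laws of sums of independent variables *)

Section laws.
Context (R : realType).

Lemma distribution_ext d1 d2 (T1 : measurableType d1) (T2 : measurableType d2)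
    (P : probability T1 R) (Q : probability T2 R)
    (X : {RV P >-> R}) (Y : {RV Q >-> R}) :
  cdf X =1 cdf Y ->
  forall A, measurable A -> distribution P X A = distribution Q Y A.
Proof.
move=> XY; apply: (measure_unique (@RGenOInfty.G R) (fun n => `](- n%:R)%R, +oo[%classic)).
- exact: RGenOInfty.measurableE.
- move=> _ _ [x ->] [y ->]; exists (Num.max x y); apply/seteqP; split => z /=;
    rewrite !in_itv/= !andbT gt_max; first by case=> -> ->.
  by move/andP.
- by move=> n; eexists.
- apply/seteqP; split => // x _; exists (Num.bound x) => //=.
  by rewrite in_itv/= andbT ltrNl unstable.ltrNbound.
- by move=> _ [x ->]; have := ccdf_1_cdf X x; rewrite XY -(ccdf_1_cdf Y).
- by move=> n; rewrite (le_lt_trans (probability_le1 _ _)) ?ltry.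
Qed.

Lemma rectangle_ext d1 d2 (T1 : measurableType d1) (T2 : measurableType d2)
    (m1 m2 : {measure set (T1 * T2) -> \bar R}) :
  (m1 setT < +oo)%E ->
  (forall A B, measurable A -> measurable B -> m1 (A `*` B) = m2 (A `*` B)) ->
  forall C, measurable C -> m1 C = m2 C.
Proof.
move=> m1oo m12.
pose G := [set A `*` B | A in @measurable _ T1 & B in @measurable _ T2].
apply: (measure_unique G (fun=> setT)).
- exact: measurable_prod_measurableType.
- move=> _ _ [A1 mA1 [B1 mB1 <-]] [A2 mA2 [B2 mB2 <-]].
  exists (A1 `&` A2); first exact: measurableI.
  by exists (B1 `&` B2); [exact: measurableI|rewrite setXI].
- by move=> _; exists setT => //; exists setT => //; rewrite setXTT.
- by rewrite bigcup_const.
- by move=> _ [A mA [B mB <-]]; exact: m12.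
- by [].
Qed.

End laws.

Section pairing.
Context d d1 d2 (T : measurableType d) (T1 : measurableType d1)
  (T2 : measurableType d2).

Definition mfun_pair (f : {mfun T >-> T1}) (g : {mfun T >-> T2}) :
    {mfun T >-> (T1 * T2)%type} :=
  mfun_Sub (mem_set (measurable_fun_pair (measurable_funPT f) (measurable_funPT g))).

End pairing.

Definition rv_sum (R : realType) d (T : measurableType d) (P : probability T R)
    (I : Type) (Y : I -> {RV P >-> R}) (s : seq I) : {RV P >-> R} :=
  \sum_(j <- s) (Y j : {mfun T >-> R}).

Lemma rv_sumE (R : realType) d (T : measurableType d) (P : probability T R)
    (I : Type) (Y : I -> {RV P >-> R}) (s : seq I) t :
  rv_sum Y s t = \sum_(j <- s) Y j t.
Proof. exact: mfun_sum. Qed.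

Section sum_independent.
Context (R : realType) d (T : measurableType d) (P : probability T R).
Variables (I : finType) (Y : I -> {RV P >-> R}).
Hypothesis Y_indep : independent_family P (fun i t => Y i t).

Let S := rv_sum Y.

Let SE s t : S s t = \sum_(j <- s) Y j t.
Proof. exact: rv_sumE. Qed.

(** Keeping the variables outside [s] in the statement is what makes the induction work: adding [j]
    to the sum takes [Y j] from the intersection. *)
Lemma independent_sum (s : seq I) (A : I -> set R) (B : set R) :
  uniq s -> (forall i, measurable (A i)) -> measurable B ->
  P (S s @^-1` B `&` \bigcap_(i in [set i | i \notin s]) (Y i @^-1` A i)) =
  (P (S s @^-1` B) * \prod_(i | i \notin s) P (Y i @^-1` A i))%E.
Proof.
elim: s A B => [|j s IH] A B /= us mA mB.
  have YA : P (\bigcap_(i in [set i | i \notin [::]]) (Y i @^-1` A i)) =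
      (\prod_(i | i \notin ([::] : seq I)) P (Y i @^-1` A i))%E.
    have := Y_indep [set: I]%SET mA.
    rewrite (_ : [set` _] = [set i | i \notin [::]]); last first.
      by apply/seteqP; split => i //= _; rewrite inE.
    by move=> ->; apply: eq_bigl => i; rewrite inE.
  have SB : S [::] @^-1` B = [set _ | B 0].
    by apply/funext => t /=; rewrite /preimage/= SE big_nil.
  have [B0|nB0] := pselect (B 0).
    rewrite (_ : S [::] @^-1` B = setT) ?SB; last first.
      by apply/seteqP; split.
    by rewrite setTI probability_setT mul1e.
  rewrite (_ : S [::] @^-1` B = set0) ?SB; last by apply/seteqP; split.
  by rewrite set0I measure0 mul0e.
case/andP: us => js us.
pose E := \bigcap_(i in [set i | i \notin j :: s]) (Y i @^-1` A i).
have mE : measurable E.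
  by apply: fin_bigcap_measurable; [exact: finite_finset|move=> i _; exact: measurable_funPTI].
pose c := (\prod_(i | i \notin j :: s) P (Y i @^-1` A i))%E.
have cfin : c \is a fin_num.
  by apply: prode_fin_num => i _; rewrite fin_num_measure//; exact: measurable_funPTI.
have c0 : 0 <= fine c by rewrite fine_ge0// prode_ge0.
pose V := mfun_pair (Y j) (S s).
(* A constraint on [Y j] is absorbed into the family, so that the induction hypothesis for [s]
   applies. *)
have bigI (A1 : set R) (A' : I -> set R) :
    Y j @^-1` A1 `&` \bigcap_(i in [set i | i \notin j :: s]) (Y i @^-1` A' i) =
    \bigcap_(i in [set i | i \notin s]) (Y i @^-1` (if i == j then A1 else A' i)).
  apply/seteqP; split => [t [/= tj tA] i /= si|t tA].
    by case: eqP => [-> //|/eqP ij]; apply: tA => /=; rewrite inE negb_or ij.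
  split; first by have := tA j js; rewrite eqxx.
  by move=> i /=; rewrite inE negb_or => /andP[/negbTE ij si]; have := tA i si; rewrite ij.
have rect A1 B1 (A' : I -> set R) :
    measurable A1 -> measurable B1 -> (forall i, measurable (A' i)) ->
    P (V @^-1` (A1 `*` B1) `&` \bigcap_(i in [set i | i \notin j :: s]) (Y i @^-1` A' i)) =
    (P (S s @^-1` B1) * P (Y j @^-1` A1) * \prod_(i | i \notin j :: s) P (Y i @^-1` A' i))%E.
  move=> mA1 mB1 mA'.
  have := IH (fun i => if i == j then A1 else A' i) B1 us _ mB1.
  rewrite (bigD1 j)//= eqxx -bigI setIA => IHe.
  rewrite (_ : V @^-1` _ = S s @^-1` B1 `&` Y j @^-1` A1); last first.
    by rewrite setIC.
  rewrite IHe; last by move=> i; case: ifP.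
  rewrite muleA; congr (_ * _)%E; apply: eq_big => i.
    by rewrite inE negb_or andbC.
  by move=> /andP[_ /negbTE ->].
(* With the event [E] fixed, both sides become finite measures of a set of values of the pair [V].
   They agree on rectangles, hence also on the set of pairs whose sum lies in [B]. *)
pose m1_ : {measure set (R * R) -> \bar R} := pushforward (mrestr P mE) V.
pose m1 := m1_ (measurable_funPT V).
pose m2 : {measure set (R * R) -> \bar R} := mscale (NngNum c0) (distribution P V).
have m12 C : measurable C -> m1 C = m2 C.
  apply: rectangle_ext.
    rewrite (_ : m1 setT = P E); last by rewrite /m1/= /pushforward/= /mrestr preimage_setT setTI.
    by rewrite (le_lt_trans (probability_le1 _ _)) ?ltry.
  move=> A1 B1 mA1 mB1.
  have -> : m1 (A1 `*` B1) = P (V @^-1` (A1 `*` B1) `&` E) by [].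
  have -> : m2 (A1 `*` B1) = (c * P (V @^-1` (A1 `*` B1)))%E.
    by rewrite /m2/= /mscale/= fineK.
  rewrite rect// -/c muleC; congr (_ * _)%E.
  (* The same formula without constraints says that [Y j] and [S s] are independent. *)
  have := rect A1 B1 (fun=> setT) mA1 mB1 (fun=> measurableT).
  rewrite (_ : \bigcap_(i in _) _ = setT) ?setIT; last by apply/seteqP; split.
  by rewrite big1 ?mule1// => i _; rewrite preimage_setT probability_setT.
have madd : measurable [set p : R * R | B (p.1 + p.2)].
  rewrite -[X in measurable X]setTI.
  by apply: (measurable_funD measurable_fst measurable_snd) => //.
have SV : S (j :: s) @^-1` B = V @^-1` [set p | B (p.1 + p.2)].
  by apply/funext => t /=; rewrite /preimage/= !SE big_cons.
rewrite SV; have := m12 _ madd.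
set D := [set p : R * R | B (p.1 + p.2)].
have -> : m2 D = (c * P (V @^-1` D))%E.
  by rewrite /m2/= /mscale/= fineK.
by rewrite muleC => <-.
Qed.

Lemma distribution_sum_cons j (s : seq I) (B : set R) :
  uniq (j :: s) -> measurable B ->
  distribution P (S (j :: s)) B =
  (distribution P (Y j) \x distribution P (S s))%E [set p | B (p.1 + p.2)].
Proof.
move=> us mB.
have madd : measurable [set p : R * R | B (p.1 + p.2)].
  rewrite -[X in measurable X]setTI.
  by apply: (measurable_funD measurable_fst measurable_snd) => //.
pose V := mfun_pair (Y j) (S s).
rewrite (@product_measure_unique _ _ _ _ _ _ _ (distribution P V))//.
  rewrite /distribution /pushforward; congr (P _); apply/funext => t /=.
  by rewrite /preimage/= !SE big_cons.
move=> A1 B1 mA1 mB1.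
have /andP[js us'] := us.
have mA1' i : measurable (if i == j then A1 else setT) by case: ifP.
have := independent_sum us' mA1' mB1.
rewrite (bigD1 j)//= eqxx big1 ?mule1; last first.
  by move=> i /andP[_ /negbTE ->]; rewrite preimage_setT probability_setT.
rewrite muleC /distribution /pushforward => <-; congr (P _).
apply/seteqP; split => [t [/= tA tB]|t [/= tB tA]].
  by split => // i /= si; case: ifP => // /eqP ->.
by split => //=; have := tA j js; rewrite eqxx.
Qed.

Lemma distribution_sum_conv j (s : seq I) (B : set R) :
  uniq (j :: s) -> measurable B ->
  distribution P (S (j :: s)) B =
  (\int[distribution P (Y j)]_x distribution P (S s) [set y | B (x + y)%R])%E.
Proof.
move=> us mB; rewrite distribution_sum_cons// /product_measure1.
by apply: eq_integral => x _ /=; congr (distribution _ _ _); apply/seteqP;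
  split => y; rewrite /xsection/= inE.
Qed.

(** Integrate with the other summand outermost: the section at [y] of the line p.1 + p.2 = x is the
    single point x - y, which is null for [Y j]. *)
Lemma distribution_sum_atomless j (s : seq I) (x : R) :
  uniq (j :: s) -> (forall y, P (Y j @^-1` [set y]) = 0%E) ->
  P (S (j :: s) @^-1` [set x]) = 0%E.
Proof.
move=> us Y0.
have := distribution_sum_cons us (measurable_set1 x).
rewrite {1}/distribution /pushforward => ->.
set A := [set p : R * R | _].
have mA : measurable A.
  rewrite -[X in measurable X]setTI.
  by apply: (measurable_funD measurable_fst measurable_snd) => //.
rewrite (@product_measure_unique _ _ _ _ _ _ _
  (distribution P (Y j) \x^ distribution P (S s))%E)//; last first.
  by move=> A1 B1 mA1 mB1; apply: product_measure2E.
transitivity ((distribution P (Y j) \x^ distribution P (S s))%E A) => //.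
rewrite /product_measure2; apply: integral0_eq => y _ /=.
rewrite (_ : ysection A y = [set x - y]); first exact: Y0.
apply/seteqP; split => z; rewrite /ysection/= inE/=; first by move=> <-; rewrite addrK.
by move=> ->; rewrite /A/= subrK.
Qed.

End sum_independent.

Section sum_ext.
Context (R : realType) d1 d2 (T1 : measurableType d1) (T2 : measurableType d2)
  (P : probability T1 R) (Q : probability T2 R) (I : finType)
  (Y : I -> {RV P >-> R}) (Z : I -> {RV Q >-> R}).
Hypothesis Y_indep : independent_family P (fun i t => Y i t).
Hypothesis Z_indep : independent_family Q (fun i t => Z i t).

(** Two probability spaces, because the log-odds are compared with logistic variables defined
    elsewhere. Applied to a family and its opposite, it also gives the symmetry of the sum. *)
Lemma distribution_sum_ext : (forall i, cdf (Y i) =1 cdf (Z i)) ->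
  forall (s : seq I) B, uniq s -> measurable B ->
  distribution P (rv_sum Y s) B = distribution Q (rv_sum Z s) B.
Proof.
move=> YZ; elim=> [|j s IH] B us mB.
  rewrite /distribution /pushforward.
  have [B0|B0] := pselect (B 0).
    have -> : rv_sum Y [::] @^-1` B = setT.
      by apply/seteqP; split=> // t _; rewrite /preimage/= rv_sumE big_nil.
    have -> : rv_sum Z [::] @^-1` B = setT.
      by apply/seteqP; split=> // t _; rewrite /preimage/= rv_sumE big_nil.
    by rewrite !probability_setT.
  have -> : rv_sum Y [::] @^-1` B = set0.
    by apply/seteqP; split=> // t; rewrite /preimage/= rv_sumE big_nil.
  have -> : rv_sum Z [::] @^-1` B = set0.
    by apply/seteqP; split=> // t; rewrite /preimage/= rv_sumE big_nil.
  by rewrite !measure0.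
rewrite (distribution_sum_conv Y_indep us mB) (distribution_sum_conv Z_indep us mB).
have /andP[_ us'] := us.
rewrite (eq_measure_integral (distribution Q (Z j))); last first.
  by move=> A mA _; apply: distribution_ext.
apply: eq_integral => x _; apply: IH => //.
rewrite -[X in measurable X]setTI; exact: (measurable_funD _ _).
Qed.

End sum_ext.

Section opposite.
Context (R : realType) d (T : measurableType d) (P : probability T R).

Definition rv_opp (X : {RV P >-> R}) : {RV P >-> R} := - (X : {mfun T >-> R}).

Lemma independent_opp (I : finType) (Y : I -> {RV P >-> R}) :
  independent_family P (fun i t => Y i t) ->
  independent_family P (fun i t => rv_opp (Y i) t).
Proof.
move=> Yi J A mA.
apply: (Yi J (fun i => -%R @^-1` A i)) => i.
by rewrite -[X in measurable X]setTI; apply: oppr_measurable.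
Qed.

Lemma cdf_opp (X : {RV P >-> R}) : (forall x, P (X @^-1` [set x]) = 0%E) ->
  (forall x, ccdf X (- x) = cdf X x) -> cdf (rv_opp X) =1 cdf X.
Proof.
move=> X0 XN x; rewrite -XN /cdf /ccdf /distribution /pushforward.
have -> : rv_opp X @^-1` `]-oo, x] = X @^-1` [set - x] `|` X @^-1` `]- x, +oo[.
  rewrite -preimage_setU setU1itv//; apply/seteqP; split => t;
  by rewrite /preimage/= !in_itv/= andbT lerNl.
rewrite measureU//; last 2 first.
- exact: measurable_funPTI.
- rewrite -preimage_setI; apply/seteqP; split => // t [/= ->].
  by rewrite in_itv/= ltxx.
by rewrite [X in (X + _)%E](X0 (- x)) add0e.
Qed.

(** The mass of a point x is at most f x - f y for every y < x. *)
Lemma continuous_cdf_atomless (X : {RV P >-> R}) (f : R -> R) :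
  (forall x, cdf X x = (f x)%:E) -> continuous f ->
  forall x, P (X @^-1` [set x]) = 0%E.
Proof.
move=> Xf cf x.
have fin : P (X @^-1` [set x]) \is a fin_num.
  by rewrite fin_num_measure//; exact: measurable_funPTI.
have le y : y < x -> fine (P (X @^-1` [set x])) <= f x - f y.
  move=> yx; rewrite -lee_fin fineK// EFinB -!Xf leeBrDr; last by rewrite Xf.
  rewrite /cdf /distribution /pushforward -measureU//; last 2 first.
  - exact: measurable_funPTI.
  - rewrite -preimage_setI; apply/seteqP; split => // t [/= ->].
    by rewrite in_itv/= leNgt yx.
  rewrite le_measure ?inE//.
  - by apply: measurableU; exact: measurable_funPTI.
  - exact: measurable_funPTI.
  - move=> t []; rewrite /preimage/= !in_itv/=; first by move=> ->.
    by move=> /le_trans; apply; exact: ltW.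
apply/eqP; rewrite -(fineK fin) eqe eq_le; apply/andP; split; last first.
  by rewrite fine_ge0.
apply/ler_addgt0Pr => e e0; rewrite add0r.
have /cvgrPdist_lt/(_ e e0)/nbhs_ballP[r /= r0] := cf x.
have r2 : 0 < r / 2 by rewrite divr_gt0.
move=> /(_ (x - r / 2)); rewrite /ball/= opprB addrC subrK gtr0_norm//.
rewrite ltr_pdivrMr// ltr_pMr// ltr1n => /(_ isT) fe.
by rewrite (le_trans (le (x - r / 2) _))// ?ltrBlDr ?ltrDl// (le_trans (ler_norm _))// ltW.
Qed.

End opposite.

(** * The standard logistic law *)

Section logistic_function.
Variable R : realType.
Implicit Types x y : R.

Definition logistic x := (1 + expR (- x))^-1.

Let den_gt0 x : 0 < 1 + expR (- x).
Proof. by rewrite addr_gt0 ?expR_gt0. Qed.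

Lemma logistic_gt0 x : 0 < logistic x.
Proof. by rewrite invr_gt0. Qed.

Lemma logisticN x : logistic (- x) = 1 - logistic x.
Proof.
rewrite /logistic opprK expRN; have := expR_gt0 x; move: (expR x) => e e0.
by field; rewrite !lt0r_neq0 ?addr_gt0.
Qed.

Lemma logistic_lt1 x : logistic x < 1.
Proof. by rewrite -subr_gt0 -logisticN logistic_gt0. Qed.

Lemma logistic_mono : {mono logistic : x y / x <= y}.
Proof.
by move=> x y; rewrite /logistic lef_pV2 ?posrE// lerD2l ler_expR lerN2.
Qed.

Lemma continuous_logistic : continuous logistic.
Proof.
move=> x; apply: cvgV; first by rewrite lt0r_neq0.
apply: cvgD; first exact: cvg_cst.
by apply: continuous_comp; [exact: opp_continuous|exact: continuous_expR].
Qed.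

(** [logistic] inverts the log-odds; this is the form in which the ratio A / (A + B) becomes a
    difference of logarithms. *)
Lemma logistic_lnB x y : 0 < x -> 0 < y -> logistic (ln x - ln y) = x / (x + y).
Proof.
move=> x0 y0; rewrite /logistic opprB expRB !lnK ?posrE//.
by field; rewrite !lt0r_neq0 ?addr_gt0.
Qed.

End logistic_function.

(** * Integrals of exponentials of a square root *)

Section integral_expR_sqrt.
Variable R : realType.
Local Notation mu := (@lebesgue_measure R).

(** At y = sqrt r this is minus an antiderivative of exp (- a sqrt r), found by substituting y for
    sqrt r and integrating by parts. *)
Let h (a y : R) := 2 / a ^+ 2 * ((1 + a * y) * expR (- (a * y))).

Let cvg_h a : 0 < a -> h a (Num.sqrt r) @[r --> +oo] --> 0.
Proof.
move=> a0.
have hE y : 0 < y -> 0 <= h a y <= (8 / a ^+ 3) * y^-1.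
  move=> y0; have ay : 0 < a * y by rewrite mulr_gt0.
  rewrite /h; apply/andP; split.
    by rewrite !mulr_ge0 ?expR_ge0 ?invr_ge0 ?exprn_ge0 ?addr_ge0 ?ltW.
  have -> : 8 / a ^+ 3 / y = 2 / a ^+ 2 * (4 / (a * y)).
    by field; rewrite !lt0r_neq0.
  rewrite ler_pM2l ?divr_gt0 ?exprn_gt0// expRN ler_pdivrMr ?expR_gt0//.
  rewrite mulrAC ler_pdivlMr//.
  (* With z = a y the claim is (1 + z) z <= 4 exp z, which follows from 4 (1 + z / 2)^2 <= 4 exp
     z. *)
  have := expR_ge1Dx (a * y / 2).
  have -> : expR (a * y) = expR (a * y / 2) ^+ 2.
    by rewrite -expRM_natl; congr expR; field.
  move: (expR _) => e; move: (a * y) ay => z z0; nra.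
apply: (@squeeze_cvgr _ _ _ _ (cst 0) (fun r => (8 / a ^+ 3) * (Num.sqrt r)^-1)).
- by near=> r; apply: hE; rewrite sqrtr_gt0; near: r; exact: nbhs_pinfty_gt.
- exact: cvg_cst.
- rewrite -[X in _ --> X](mulr0 (8 / a ^+ 3)); apply: cvgMr.
  apply/cvgrPdist_le => /= e e0; near=> r.
  have r0 : 0 < r by near: r; exact: nbhs_pinfty_gt.
  rewrite sub0r normrN gtr0_norm ?invr_gt0 ?sqrtr_gt0//.
  rewrite invf_ple ?posrE ?sqrtr_gt0// -[e^-1]ger0_norm ?invr_ge0 ?(ltW e0)//.
  rewrite -sqrtr_sqr ler_wsqrtr//; near: r; apply: nbhs_pinfty_ge.
Unshelve. all: end_near. Qed.

Let derive_h a (r : R) : 0 < a -> 0 < r ->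
  is_derive r 1 (fun r => h a (Num.sqrt r)) (- expR (- (a * Num.sqrt r))).
Proof.
move=> a0 r0; have s0 : 0 < Num.sqrt r by rewrite sqrtr_gt0.
have ds := is_derive1_sqrt r0.
have dh : is_derive (Num.sqrt r) 1 (h a) (- (2 * Num.sqrt r * expR (- (a * Num.sqrt r)))).
  rewrite /h; apply: is_derive_eq.
  rewrite add0r /GRing.scale/= !mulr1.
  by field; rewrite lt0r_neq0.
have dc := is_derive1_comp dh ds; apply: is_derive_eq dc _.
rewrite /GRing.scale/=; field.
by rewrite lt0r_neq0.
Qed.

Lemma continuous_expR_sqrt a : continuous (fun r : R => expR (- (a * Num.sqrt r))).
Proof.
move=> x; apply: continuous_comp; last exact: continuous_expR.
by apply: cvgN; apply: cvgMr; exact: sqrt_continuous.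
Qed.

Let cont_h a : continuous (fun r : R => h a (Num.sqrt r)).
Proof.
move=> x; apply: cvgMr; apply: cvgM; last exact: continuous_expR_sqrt.
by apply: cvgD; [exact: cvg_cst|apply: cvgMr; exact: sqrt_continuous].
Qed.

Lemma integral_expR_sqrtB a b : 0 < a <= b ->
  (\int[mu]_(r in `[0%R, +oo[)
     (expR (- (a * Num.sqrt r)) - expR (- (b * Num.sqrt r)))%:E)%E
  = (2 / a ^+ 2 - 2 / b ^+ 2)%:E.
Proof.
move=> /andP[a0 ab]; have b0 : 0 < b by exact: lt_le_trans ab.
pose F r := h b (Num.sqrt r) - h a (Num.sqrt r).
have F0 : F 0 = 2 / b ^+ 2 - 2 / a ^+ 2.
  by rewrite /F /h sqrtr0 !mulr0 addr0 oppr0 expR0 !mulr1.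
have dF (x : R) : 0 < x -> is_derive x 1 F
    (- expR (- (b * Num.sqrt x)) - - expR (- (a * Num.sqrt x))).
  by move=> x0; exact: is_deriveB (derive_h b0 x0) (derive_h a0 x0).
rewrite (@ge0_continuous_FTC2y _ _ F 0 0).
- by rewrite F0 -EFinB sub0r opprB.
- move=> x x0; rewrite subr_ge0 ler_expR lerN2 ler_wpM2r// sqrtr_ge0.
- apply: continuous_subspaceT => x; apply: cvgB.
    exact: continuous_expR_sqrt.
  exact: continuous_expR_sqrt.
- by rewrite -[X in _ --> X](subr0 0); exact: cvgB (cvg_h b0) (cvg_h a0).
- by move=> x x0; case: (dF x x0).
- by apply: cvg_at_right_filter; exact: (continuousB (@cont_h b 0) (@cont_h a 0)).
- move=> x; rewrite in_itv/= andbT => x0.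
  by rewrite derive1E; case: (dF x x0) => _ ->; rewrite opprK addrC.
Qed.

End integral_expR_sqrt.

Section logistic_moments.
Variable R : realType.
Local Notation mu := (@lebesgue_measure R).

(** With q = exp (- sqrt r), the integrand is 2 q / (1 + q), an alternating geometric series.
    Grouping its terms in pairs makes them nonnegative, so that sum and integral may be exchanged;
    each pair integrates by [integral_expR_sqrtB]. *)
Lemma integral_logistic_sqrt :
  (\int[mu]_(r in `[0%R, +oo[) (2 * logistic (- Num.sqrt r))%:E)%E
  = (pi ^+ 2 / 3)%:E.
Proof.
pose e k (r : R) := expR (- ((2 * k).+1%:R * Num.sqrt r)) - expR (- ((2 * k).+2%:R * Num.sqrt r)).
have e0 k r : 0 <= r -> 0 <= e k r.
  by move=> r0; rewrite subr_ge0 ler_expR lerN2 ler_wpM2r ?sqrtr_ge0// ler_nat.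
have me D k : measurable_fun D (e k).
  apply: measurable_funTS; apply: continuous_measurable_fun => r.
  by apply: cvgB; exact: continuous_expR_sqrt.
have sume r : 0 < r ->
    (\sum_(0 <= k <oo) (2 * e k r)%:E)%E = (2 * logistic (- Num.sqrt r))%:E.
  move=> r0; set s := Num.sqrt r; have s0 : 0 < s by rewrite sqrtr_gt0.
  pose q := expR (- s).
  have q0 : 0 < q by exact: expR_gt0.
  have q1 : q < 1 by rewrite expR_lt1 oppr_lt0.
  have eE k : e k r = q ^+ (2 * k).+1 - q ^+ (2 * k).+2.
    rewrite /e -/s -[- (_ * s)]mulrN -[- (_.+2%:R * s)]mulrN.
    by rewrite !expRM_natl.
  have lE : logistic (- s) = q / (1 + q).
    rewrite /logistic opprK /q expRN; have := expR_gt0 s; move: (expR s) => z z0.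
    by field; rewrite !lt0r_neq0 ?addr_gt0.
  have partial n : \sum_(0 <= k < n) (2 * e k r) = 2 * (q / (1 + q)) * (1 - (q ^+ 2) ^+ n).
    elim: n => [|n IH]; first by rewrite big_nil expr0 subrr mulr0.
    rewrite big_nat_recr//= IH eE [q ^+ (2 * n).+2]exprS [q ^+ (2 * n).+1]exprS exprM.
    rewrite [(q ^+ 2) ^+ _.+1]exprS; move: ((q ^+ 2) ^+ n) => z; field.
    by rewrite lt0r_neq0 ?addr_gt0.
  apply/cvg_lim => //; rewrite lE.
  under eq_fun do rewrite sumEFin partial.
  apply: cvg_EFin; first exact: nearW.
  rewrite -[X in _ --> X]mulr1; apply: cvgMr.
  rewrite -[X in _ --> X]subr0; apply: cvgB; first exact: cvg_cst.
  by apply: cvg_expr; rewrite ger0_norm ?exprn_ge0 ?(ltW q0)// expr_lt1 ?ltW.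
(* At r = 0 all pairs vanish while the integrand is 1, so the endpoint is removed first. *)
rewrite -integral_itv_obnd_cbnd; last first.
  apply/measurable_EFinP; apply: measurable_funTS.
  apply: continuous_measurable_fun => r.
  have cs : {for r, continuous (fun r : R => - Num.sqrt r)}.
    by apply: cvgN; exact: sqrt_continuous.
  by apply: cvgMr; exact: (continuous_comp cs (@continuous_logistic R _)).
transitivity (\int[mu]_(r in `]0%R, +oo[) \sum_(0 <= k <oo) (2 * e k r)%:E)%E.
  by apply: eq_integral => r; rewrite inE/= in_itv/= andbT => r0; rewrite sume.
rewrite integral_nneseries//; last 2 first.
- by move=> k; apply/measurable_EFinP; apply: measurable_funM => //; exact: me.
- by move=> k r /=; rewrite in_itv/= andbT => r0; rewrite lee_fin mulr_ge0// e0// ltW.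
have int k : (\int[mu]_(r in `]0%R, +oo[) (2 * e k r)%:E)%E =
    (4 * (((2 * k).+1%:R ^+ 2)^-1 - ((2 * k).+2%:R ^+ 2)^-1))%:E.
  rewrite integral_itv_obnd_cbnd; last first.
    by apply/measurable_EFinP; apply: measurable_funM => //; exact: me.
  under eq_integral do rewrite EFinM.
  rewrite ge0_integralZl//; last 2 first.
  - by apply/measurable_EFinP; exact: me.
  - by move=> r /=; rewrite in_itv/= andbT => r0; rewrite lee_fin e0.
  rewrite integral_expR_sqrtB; last by rewrite ltr0n/= ler_nat.
  by rewrite -EFinM; congr EFin; ring.
rewrite (eq_eseriesr (fun k _ => int k)).
apply/cvg_lim => //.
under eq_fun do rewrite sumEFin -mulr_sumr.
apply: cvg_EFin; first exact: nearW.
rewrite (_ : pi ^+ 2 / 3 = 4 * (pi ^+ 2 / 12)); last by field.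
apply: cvgMr.
under eq_fun do rewrite big_mkord.
exact: sum_alternating_invsqr.
Qed.

Section std_logistic.
Context d (T : measurableType d) (P : probability T R) (X : {RV P >-> R}).
Hypothesis cdfX : forall x, cdf X x = (logistic x)%:E.

Lemma logistic_atomless x : P (X @^-1` [set x]) = 0%E.
Proof. exact: (continuous_cdf_atomless cdfX (@continuous_logistic R)). Qed.

Lemma logistic_ccdf x : ccdf X x = (logistic (- x))%:E.
Proof. by rewrite ccdf_1_cdf cdfX logisticN EFinB. Qed.

Lemma cdf_opp_logistic : cdf (rv_opp X) =1 cdf X.
Proof.
apply: cdf_opp; first exact: logistic_atomless.
by move=> x; rewrite logistic_ccdf opprK cdfX.
Qed.

Lemma logistic_norm_gt x : 0 <= x ->
  P [set t | x < `|X t|] = (2 * logistic (- x))%:E.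
Proof.
move=> x0; have -> : [set t | x < `|X t|] = X @^-1` `]x, +oo[ `|` rv_opp X @^-1` `]x, +oo[.
  apply/seteqP; split => t; rewrite /preimage/= !in_itv/= !andbT lter_normr.
    by move/orP.
  by case=> ->; rewrite ?orbT.
rewrite measureU//; last 3 first.
- exact: measurable_funPTI.
- exact: measurable_funPTI.
- apply/seteqP; split => // t; rewrite /preimage/= !in_itv/= !andbT => -[xX xNX].
  have {xNX} : x < - X t by []; lra.
have E1 : distribution P X `]x, +oo[ = (logistic (- x))%:E := logistic_ccdf x.
have E2 : distribution P (rv_opp X) `]x, +oo[ = (logistic (- x))%:E.
  by rewrite -E1; exact: distribution_ext cdf_opp_logistic _ (measurable_itv _).
transitivity ((logistic (- x))%:E + (logistic (- x))%:E)%E; first by congr (_ + _)%E.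
by rewrite -EFinD mulrDl mul1r.
Qed.

(** Integrate the tail of X^2: the event r < X^2 is sqrt r < |X|, of mass 2 logistic (- sqrt r). *)
Lemma logistic_second_moment : ('E_P[(X : {mfun T >-> R}) ^+ 2])%E = (pi ^+ 2 / 3)%:E.
Proof.
rewrite (@ge0_expectation_ccdf _ _ _ P ((X : {mfun T >-> R}) ^+ 2)); last first.
  by move=> t; rewrite mfunX sqr_ge0.
rewrite -integral_logistic_sqrt; apply: eq_integral => r.
rewrite inE/= in_itv/= andbT => r0.
rewrite -logistic_norm_gt ?sqrtr_ge0// /ccdf /distribution /pushforward.
rewrite (mfunX X 2); congr (P _); apply/seteqP; split => t; rewrite /preimage/= in_itv/= andbT.
  by move=> rX; rewrite -sqrtr_sqr ltr_sqrt ?(le_lt_trans r0 rX).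
move=> /= rX; rewrite -(sqr_sqrtr r0) -(real_normK (num_real (X t))).
by rewrite ltr_pXn2r ?nnegrE ?sqrtr_ge0.
Qed.

End std_logistic.

End logistic_moments.

(** * Recovering location and scale from mean and variance *)

Section logistic_standardization.
Context (R : realType) d (T : measurableType d) (P : probability T R).

Lemma Lfun2_of_sqr (X : {RV P >-> R}) :
  ('E_P[(X : {mfun T >-> R}) ^+ 2] < +oo)%E -> (X : T -> R) \in Lfun P 2%:E.
Proof.
move=> EX; rewrite inE; apply/andP; split; rewrite inE/=.
  exact: measurable_funPT.
rewrite /finite_norm unlock.
apply: poweR_lty; apply: le_lt_trans EX.
rewrite unlock le_eqVlt; apply/orP; left; apply/eqP.
apply: eq_integral => t _ /=.
rewrite mfunX.
by rewrite powR_mulrn ?normr_ge0// real_normK ?num_real.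
Qed.

Lemma std_logistic_Lfun2 (X : {RV P >-> R}) :
  (forall x, cdf X x = (logistic x)%:E) -> (X : T -> R) \in Lfun P 2%:E.
Proof.
by move=> cX; apply: Lfun2_of_sqr; rewrite logistic_second_moment// ltry.
Qed.

(** [X] and its opposite have the same law, so the mean equals its opposite; it is finite because
    the second moment is. *)
Lemma std_logistic_mean (X : {RV P >-> R}) :
  (forall x, cdf X x = (logistic x)%:E) -> ('E_P[X])%E = 0%E.
Proof.
move=> cX; have X2 := std_logistic_Lfun2 cX.
have Pfin : P setT \is a fin_num by rewrite probability_setT.
have X1 := Lfun_subset12 Pfin X2.
have iX : P.-integrable setT (EFin \o X) by exact/Lfun1_integrable.
have iNX : P.-integrable setT (EFin \o rv_opp X).
  have -> : EFin \o rv_opp X = (fun t => - (EFin \o X) t)%E by [].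
  exact: integrableN.
have E1 : (\int[distribution P X]_y y%:E = 'E_P[X])%E.
  by rewrite unlock integral_distribution.
have E2 : (\int[distribution P (rv_opp X)]_y y%:E = - 'E_P[X])%E.
  rewrite integral_distribution// unlock -integralN//.
  exact: integrable_add_def.
have E3 : (\int[distribution P (rv_opp X)]_y y%:E = \int[distribution P X]_y y%:E)%E.
  apply: eq_measure_integral => A mA _.
  exact: (distribution_ext (cdf_opp_logistic cX)).
have fE : ('E_P[X])%E \is a fin_num by exact: expectation_fin_num.
move: E3; rewrite E1 E2 -(fineK fE) -EFinN => -[] h.
by congr EFin; lra.
Qed.

(** (Z - m) / s is standard logistic, so Z has mean m and variance s^2 pi^2 / 3; since s > 0, the
    hypotheses leave only m = 0 and s = 1. *)
Lemma logistic_rv_cdf (Z : {RV P >-> R}) :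
  logistic_rv Z -> ('E_P[Z])%E = 0%E -> ('V_P[Z])%E = (pi ^+ 2 / 3)%:E ->
  forall x, cdf Z x = (logistic x)%:E.
Proof.
move=> [m [s [s0 cZ]]] EZ VZ.
pose Z0 : {RV P >-> R} := s^-1 \o* (Z \- cst m).
have cZ0 x : cdf Z0 x = (logistic x)%:E.
  have -> : cdf Z0 x = cdf Z (m + s * x).
    rewrite /cdf /distribution /pushforward; congr (P _).
    apply/seteqP; split => t; rewrite /preimage/= !in_itv/=;
      by rewrite ler_pdivrMr// lerBlDl mulrC.
  by rewrite cZ addrAC subrr add0r mulrAC mulfV ?mul1r// gt_eqF.
have L2 := std_logistic_Lfun2 cZ0.
have Pfin : P setT \is a fin_num by rewrite probability_setT.
have L1 := Lfun_subset12 Pfin L2.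
have ZE : (Z : T -> R) = (s \o* Z0) \+ cst m.
  by apply/funext => t /=; rewrite divfK ?subrK// lt0r_neq0.
have Ls : s \o* Z0 \in Lfun P 1 by exact: Lfun_scale.
have m0 : m = 0.
  move: EZ; rewrite ZE expectationD//; last exact: Lfun_cst.
  by rewrite expectationZl// std_logistic_mean// mule0 add0e expectation_cst => -[].
have Ls2 : s \o* Z0 \in Lfun P 2%:E by apply: Lfun_scale => //; rewrite ler1n.
have s1 : s = 1.
  move: VZ; rewrite ZE varianceD_cst_r// varianceZ// varianceE//.
  rewrite std_logistic_mean// expe2 mule0 sube0 (logistic_second_moment cZ0) -EFinM => -[].
  have := pi_gt0 R; move: (pi : R) => p p0 /eqP.
  rewrite -subr_eq0 -[X in _ - X]mul1r -mulrBl mulf_eq0 subr_eq0 => /orP[|]; last first.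
    by rewrite gt_eqF// divr_gt0// exprn_gt0.
  by rewrite sqrf_eq1 => /orP[/eqP//|/eqP sN]; lra.
by move=> x; rewrite cZ m0 s1 subr0 divr1.
Qed.

End logistic_standardization.

(** * Concentration of sums of logistic variables *)

Section windows.
Variable R : realType.

(* The probability that the walk with step law (1/4, 1/2, 1/4) on {-1, 0, 1}
   ends after [n] steps in the [2 r] central sites -r, ..., r - 1. *)
Definition window (n r : nat) : R :=
  (\sum_(i < r) 'C((2 * n).+1, n.+1 + i))%:R / 4 ^+ n.

Lemma window0 n : window n 0 = 0.
Proof. by rewrite /window big_ord0 mul0r. Qed.

Lemma window_ge0 n r : 0 <= window n r.
Proof. by rewrite divr_ge0// exprn_ge0. Qed.

Lemma window0S r : window 0 r.+1 = 1.
Proof.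
rewrite /window expr0 divr1 big_ord_recl/= big1 ?addn0 ?binn//.
Qed.

(** One step of the walk: the central window shifted one site to the left and one to the right
    covers, with multiplicity, the next larger and the next smaller central window. In binomial
    terms, Pascal's rule is used twice, and the central symmetry at the innermost term. *)
Lemma windowS n r :
  window n.+1 r.+1 = (window n r.+2 + 2 * window n r.+1 + window n r) / 4.
Proof.
suff E : (\sum_(i < r.+1) 'C((2 * n.+1).+1, n.+2 + i) =
    \sum_(i < r.+2) 'C((2 * n).+1, n.+1 + i) +
    2 * (\sum_(i < r.+1) 'C((2 * n).+1, n.+1 + i)) +
    \sum_(i < r) 'C((2 * n).+1, n.+1 + i))%N.
  rewrite /window E natrD [X in (X + _) / _]natrD natrM exprS; field.
  by rewrite expf_neq0.
have nE : (2 * n.+1).+1 = (2 * n).+3 by rewrite mulnS.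
have bin2S m k : 'C(m.+2, k.+2) = ('C(m, k.+2) + 2 * 'C(m, k.+1) + 'C(m, k))%N.
  by rewrite !binS; lia.
elim: r => [|r IH].
  rewrite !big_ord_recr !big_ord0/= !addn0 nE !addn1 bin2S.
  have -> : 'C((2 * n).+1, n) = 'C((2 * n).+1, n.+1).
    by rewrite -bin_sub//; [congr binomial|]; lia.
  by lia.
rewrite big_ord_recr/= IH nE !addnS !addSn bin2S.
pose S k := (\sum_(i < k) 'C((2 * n).+1, n.+1 + i))%N.
have SS k : S k.+1 = (S k + 'C((2 * n).+1, n.+1 + k))%N by rewrite /S big_ord_recr.
by rewrite -!/(S _) !SS !addnS !addSn; lia.
Qed.

(** Induction through the ratio (2n + 3) / (2n + 4) of consecutive terms. The 4 gives equality at n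
    = 0, and the slope 3 is small enough for the step. *)
Lemma window1_le n : window n 1 ^+ 2 * (3 * n%:R + 4) <= 4.
Proof.
elim: n => [|n IH]; first by rewrite window0S; lra.
have E : (n%:R + 2) * window n.+1 1 = (2 * n%:R + 3) / 2 * window n 1.
  have binE : (n.+2 * 'C((2 * n).+3, n.+2) = 2 * (2 * n).+3 * 'C((2 * n).+1, n.+1))%N.
    rewrite -mul_bin_diag/= binS.
    have -> : 'C((2 * n).+1, n) = 'C((2 * n).+1, n.+1).
      by rewrite -bin_sub//; [congr binomial|]; lia.
    by lia.
  rewrite /window !big_ord1 !addn0.
  have -> : (2 * n.+1).+1 = (2 * n).+3 by rewrite mulnS.
  have H : (n%:R + 2) * ('C((2 * n).+3, n.+2))%:R =
      2 * (2 * n%:R + 3) * ('C((2 * n).+1, n.+1))%:R :> R.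
    by rewrite -natrD addn2 -natrM binE !natrM -addn3 natrD natrM.
  rewrite exprS.
  rewrite [LHS]mulrA H; field.
  by rewrite expf_neq0.
have := window_ge0 n 1; have := window_ge0 n.+1 1.
move: (window n 1) (window n.+1 1) IH E => w w' IH E w'0 w0.
have n0 : 0 <= n%:R :> R by [].
rewrite -[n.+1%:R]natr1; move: (n%:R : R) n0 IH E => x x0 IH E.
have E2 : (x + 2) ^+ 2 * w' ^+ 2 = ((2 * x + 3) / 2) ^+ 2 * w ^+ 2.
  by rewrite -!exprMn E.
have x2 : 0 < (x + 2) ^+ 2 by rewrite exprn_gt0//; lra.
rewrite -(ler_pM2l x2) mulrA E2.
(* The right side exceeds the left one by (x + 1) / 4. *)
have H1 : ((2 * x + 3) / 2) ^+ 2 * (3 * (x + 1) + 4) <= (x + 2) ^+ 2 * (3 * x + 4) by nra.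
rewrite mulrAC; apply: (@le_trans _ _ ((x + 2) ^+ 2 * (3 * x + 4) * w ^+ 2)).
  by rewrite ler_wpM2r ?sqr_ge0.
by rewrite -mulrA ler_pM2l// mulrC.
Qed.

End windows.

(** * Littlewood-Offord bound for logistic sums *)

Section anticoncentration.
Context (R : realType) d (T : measurableType d) (P : probability T R).
Variables (I : finType) (Y : I -> {RV P >-> R}).
Hypothesis Y_indep : independent_family P (fun i t => Y i t).
Hypothesis Y_cdf : forall i x, cdf (Y i) x = (logistic x)%:E.

Let m : R := ln 3.

Let cell (x : R) : set R := `[x, x + 2 * m[.

Let F s (x : R) := distribution P (rv_sum Y s) (cell x).

Let mcell x : measurable (cell x). Proof. exact: measurable_itv. Qed.

Let m_gt0 : 0 < m. Proof. by rewrite ln_gt0// ltr1n. Qed.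

Let median i : P [set t | m < `|Y i t|] = (2^-1)%:E.
Proof.
rewrite (logistic_norm_gt (Y_cdf i)); last exact: ltW.
by congr EFin; rewrite /logistic opprK lnK ?posrE//; field.
Qed.

Let cellE (x y : R) : [set z | cell x (y + z)] = cell (x - y).
Proof.
apply/seteqP; split => z; rewrite /cell/= !in_itv/= => /andP[h1 h2];
  by apply/andP; split; lra.
Qed.

Let F_measurable s (x : R) : measurable_fun setT (fun y : R => F s (x - y)).
Proof.
pose D := [set p : R * R | cell x (p.1 + p.2)].
have mD : measurable D.
  rewrite -[X in measurable X]setTI.
  apply: (measurable_funD measurable_fst measurable_snd) => //.
rewrite (_ : (fun y => _) = distribution P (rv_sum Y s) \o xsection D).
  exact: measurable_fun_xsection.
apply/funext => y /=; rewrite /F -cellE; congr distribution.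
by apply/seteqP; split => z; rewrite /xsection/= inE.
Qed.

Let F_conv j s x : uniq (j :: s) ->
  F (j :: s) x = (\int[P]_t F s (x - Y j t))%E.
Proof.
move=> us; rewrite /F (distribution_sum_conv Y_indep us (measurable_itv _)).
under eq_integral do rewrite cellE.
by rewrite ge0_integral_distribution//; exact: F_measurable.
Qed.

Let F_integral_opp j s x :
  (\int[P]_t F s (x - Y j t) = \int[P]_t F s (x + Y j t))%E.
Proof.
transitivity (\int[distribution P (Y j)]_y F s (x - y))%E.
  by rewrite ge0_integral_distribution//; exact: F_measurable.
transitivity (\int[distribution P (rv_opp (Y j))]_y F s (x - y))%E.
  apply: eq_measure_integral => A mA _.
  by apply/esym; exact: (distribution_ext (cdf_opp_logistic (Y_cdf j))).
rewrite ge0_integral_distribution//.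
by apply: eq_integral => t _ /=; rewrite opprK.
Qed.

Let sum_F_le1 s (x : nat -> R) r : (forall i, x i + 2 * m <= x i.+1) ->
  (\sum_(i < r) F s (x i) <= 1)%E.
Proof.
move=> xS; apply: (@le_trans _ _ (distribution P (rv_sum Y s) `]-oo, x r[)); last first.
  exact: probability_le1.
elim: r => [|r IH]; first by rewrite big_ord0.
rewrite big_ord_recr/=; apply: (le_trans (leeD2r _ IH)).
rewrite /F -measureU//; last first.
  apply/seteqP; split => // z; rewrite /cell/= !in_itv/= => -[z1 /andP[z2 _]].
  by move: z1; rewrite ltNge z2.
apply: le_measure; rewrite ?inE//; first exact: measurableU.
move=> z; have := xS r; have := m_gt0.
by move=> m0 xr []; rewrite /cell/= !in_itv/=; [|move=> /andP[_]]; lra.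
Qed.

(* Condition on the last summand [y]: the cells shift by [-y] or [y] with equal
   probability. If [y] exceeds the median [m] of its modulus, then moving the
   topmost cell of the second family to the first one leaves two families of
   [r + 1] and [r - 1] cells that are still spaced by [2 m]. *)
Lemma sum_cells_le (s : seq I) (r : nat) (x : nat -> R) : uniq s ->
  (forall i, x i + 2 * m <= x i.+1) ->
  (\sum_(i < r) F s (x i) <= (window R (size s) r)%:E)%E.
Proof.
elim: s r x => [|j s IH] [|r] x us xS.
- by rewrite big_ord0 window0.
- by rewrite window0S; exact: sum_F_le1.
- by rewrite big_ord0 window0.
have us' : uniq s by case/andP: us.
pose a := window R (size s) r.+2 + window R (size s) r.
pose b := 2 * window R (size s) r.+1.
pose G y := (\sum_(i < r.+1) (F s (x i - y) + F s (x i + y)))%E.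
have Gb y : (G y <= b%:E)%E.
  rewrite /G big_split/= /b mulr_natl mulr2n EFinD; apply: leeD.
    by apply: (IH r.+1 (fun i => x i - y)) => // i; rewrite addrAC lerD2r.
  by apply: (IH r.+1 (fun i => x i + y)) => // i; rewrite addrAC lerD2r.
have Ga' y : m < y -> (G y <= a%:E)%E.
  move=> my; rewrite /G big_split/= [X in (_ + X)%E]big_ord_recr/=.
  rewrite [X in (_ + X)%E]addeC addeA /a EFinD; apply: leeD; last first.
    by apply: (IH r (fun i => x i + y)) => // i; rewrite addrAC lerD2r.
  (* The r + 1 cells shifted down, topped by the last cell shifted up: the gap between these last
     two starting points is 2 y > 2 m. Later indices are filled only to keep the spacing condition
     for all i. *)
  pose x' i := if (i < r.+1)%N then x i - y else x i.-1 + y.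
  apply: le_trans (IH r.+2 x' us' _); last first.
    move=> i; rewrite /x'; have := xS i.
    case: (ltnP i.+1 r.+1) => ir; first by rewrite (ltn_trans (ltnSn i) ir); lra.
    case: (ltnP i r.+1) => ir' /=; first by lra.
    by have := xS i.-1; rewrite prednK ?(leq_trans _ ir')//; lra.
  rewrite [leRHS]big_ord_recr/= /x' ltnn/=.
  apply: leeD => //; rewrite le_eqVlt; apply/orP; left; apply/eqP.
  by apply: eq_bigr => i _; rewrite ltn_ord.
have Ga y : m < `|y| -> (G y <= a%:E)%E.
  have [y0|y0] := leP 0 y; first by rewrite ger0_norm//; exact: Ga'.
  rewrite ltr0_norm// => /Ga'; rewrite /G.
  by under eq_bigr do rewrite opprK addeC.
set A := (\sum_(i < r.+1) F (j :: s) (x i))%E.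
have mF y : measurable_fun setT (fun t => F s (y - Y j t)).
  exact: measurableT_comp (F_measurable s y) (measurable_funPT (Y j)).
have mF' y : measurable_fun setT (fun t => F s (y + Y j t)).
  under eq_fun do rewrite -[Y j _]opprK.
  apply: (measurableT_comp (F_measurable s y)).
  exact: (measurable_funPT (rv_opp (Y j))).
have AE : (A + A = \int[P]_t G (Y j t))%E.
  rewrite /G; under [RHS]eq_integral do rewrite big_split/=.
  rewrite ge0_integralD//; last 4 first.
  - by move=> t _; exact: sume_ge0.
  - exact: emeasurable_sum.
  - by move=> t _; exact: sume_ge0.
  - exact: emeasurable_sum.
  rewrite !ge0_integral_sum//.
  by congr (_ + _)%E; apply: eq_bigr => i _; rewrite F_conv// F_integral_opp.
have mG : measurable_fun setT (fun t => G (Y j t)).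
  by apply: emeasurable_sum => i; exact: emeasurable_funD.
have G0 y : (0 <= G y)%E by apply: sume_ge0 => i _; exact: adde_ge0.
pose B := [set t | m < `|Y j t|].
have mB : measurable B.
  rewrite -[X in measurable X]setTI.
  have -> : B = (fun t => `|Y j t|) @^-1` `]m, +oo[.
    by apply/seteqP; split => t; rewrite /B/= in_itv/= andbT.
  exact: (measurableT_comp (@normr_measurable R setT) (measurable_funPT (Y j))).
have PB : P B = (2^-1)%:E by exact: median.
(* [B] and its complement both have mass 1/2, so A <= (a + b) / 4, which is the recurrence
   [windowS]. *)
have AA : (A + A <= ((a + b) / 2)%:E)%E.
  have mCB : measurable (~` B) by exact: measurableC.
  have mGU : measurable_fun (B `|` ~` B) (fun t => G (Y j t)) by exact: measurable_funTS.
  have dB : [disjoint B & ~` B] by rewrite disj_set2E setICr.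
  rewrite AE -(setUv B) ge0_integral_setU//.
  rewrite mulrDl EFinD; apply: leeD.
    apply: (@le_trans _ _ (\int[P]_(t in B) a%:E)%E).
      apply: ge0_le_integral => //.
      - exact: measurable_funTS.
      - by move=> t; exact: Ga.
    by rewrite integral_cst// [X in (_ * X)%E]PB -EFinM.
  apply: (@le_trans _ _ (\int[P]_(t in ~` B) b%:E)%E).
    apply: ge0_le_integral => //.
    exact: measurable_funTS.
  rewrite integral_cst//.
  rewrite [X in (_ * X)%E]probability_setC// [X in (_ - X)%E]PB -EFinB -EFinM lee_fin.
  by rewrite (_ : 1 - 2^-1 = 2^-1 :> R)//; field.
have Afin : A \is a fin_num.
  by apply/sum_fin_numP => i _ _; rewrite fin_num_measure.
rewrite -(fineK Afin) lee_fin windowS.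
move: AA; rewrite -(fineK Afin) -EFinD lee_fin /a /b; lra.
Qed.

Lemma cell_le (s : seq I) (x : R) : uniq s ->
  (distribution P (rv_sum Y s) `[x, (x + 2 * ln 3)%R[ <= (window R (size s) 1)%:E)%E.
Proof.
move=> us.
have := @sum_cells_le s 1 (fun i => x + i%:R * (2 * m)) us.
rewrite big_ord1 mul0r addr0; apply => i.
suff -> : x + i.+1%:R * (2 * m) = x + i%:R * (2 * m) + 2 * m by [].
by rewrite -[i.+1%:R]natr1; ring.
Qed.

Lemma interval_le (s : seq I) (x : R) r : uniq s ->
  (distribution P (rv_sum Y s) `[x, (x + r%:R * (2 * ln 3))%R[ <=
   (r%:R * window R (size s) 1)%:E)%E.
Proof.
move=> us; elim: r => [|r IH].
  by rewrite !mul0r addr0 set_itvE measure0.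
have := m_gt0; rewrite -/m => m0.
have -> : x + r.+1%:R * (2 * m) = (x + r%:R * (2 * m)) + 2 * m.
  by rewrite -[r.+1%:R]natr1; ring.
have r0 : 0 <= r%:R * (2 * m) by rewrite !mulr_ge0// ltW.
have -> : `[x, (x + r%:R * (2 * m) + 2 * m)[%classic =
   `[x, (x + r%:R * (2 * m))[%classic `|` cell (x + r%:R * (2 * m)).
  move: (r%:R * (2 * m)) r0 => y y0.
  apply/seteqP; split => z; rewrite /cell/= !in_itv/=; last first.
    by case=> /andP[z1 z2]; apply/andP; split; lra.
  move=> /andP[z1 z2]; case: (ltP z (x + y)) => z3.
    by left; rewrite z1.
  by right.
have -> : r.+1%:R * window R (size s) 1 = r%:R * window R (size s) 1 + window R (size s) 1.
  by rewrite -[r.+1%:R]natr1; ring.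
rewrite EFinD.
apply: le_trans (leeD IH (cell_le _ us)).
by apply: measureU2.
Qed.

Lemma anticoncentration (s : seq I) (y : R) : uniq s -> (0 < size s)%N -> 2 <= y ->
  (distribution P (rv_sum Y s) `[(- ln (y - 1))%R, ln (y - 1)] <=
   (y / Num.sqrt (size s)%:R)%:E)%E.
Proof.
move=> us s0 y2; set L := ln (y - 1).
have v1 : 1 <= y - 1 by lra.
have L0 : 0 <= L by exact: ln_ge0.
have m0 : 0 < m := m_gt0.
(* Strictly more than L / m, so that r half-open cells starting at - L cover the closed interval up
   to L. *)
pose r := (Num.truncn (L / m)).+1.
have rL : L < r%:R * m by rewrite -ltr_pdivrMr// truncnS_gt.
have rle : r%:R <= L / m + 1.
  by rewrite -natr1 lerD2r truncn_le// divr_ge0// ltW.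
apply: (@le_trans _ _ (distribution P (rv_sum Y s) `[(- L)%R, (- L + r%:R * (2 * m))%R[)).
  apply: le_measure; rewrite ?inE//.
  by apply: subset_itvl; rewrite bnd_simp; lra.
apply: le_trans (interval_le _ _ us) _.
rewrite lee_fin; set n := size s in s0 *.
(* [ln v <= 2 (sqrt v - 1)] and [ln 3 >= 2 / 3] *)
pose u := Num.sqrt (y - 1).
have u0 : 0 <= u by exact: sqrtr_ge0.
have u2 : u ^+ 2 = y - 1 by rewrite sqr_sqrtr//; lra.
have up : 0 < u by rewrite sqrtr_gt0; lra.
have Lu : L <= 2 * (u - 1).
  rewrite /L -u2 lnXn// -[ln u *+ 2]mulr_natl ler_pM2l//.
  by have := @le_ln1Dx R (u - 1); rewrite [1 + _]addrC subrK; apply; lra.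
have m23 : 2 / 3 <= m.
  have := @le_ln1Dx R (- (2 / 3)).
  rewrite (_ : 1 + _ = 3^-1); last by field.
  by rewrite lnV ?posrE// -/m => H; lra.
have ru : r%:R <= 3 * u - 2.
  have : L / m <= 3 * (u - 1).
    rewrite ler_pdivrMr//; nra.
  lra.
have n0 : 0 < n%:R :> R by rewrite ltr0n.
have sn0 : 0 < Num.sqrt n%:R :> R by rewrite sqrtr_gt0.
(* 7/6 is a rational number just above 2 / sqrt 3, the constant of [window1_le]. *)
have wn : window R n 1 * Num.sqrt n%:R <= 7 / 6.
  have W := window1_le R n; have w0 := window_ge0 R n 1.
  rewrite -(@ler_pXn2r _ 2)// ?nnegrE ?mulr_ge0 ?(ltW sn0)//.
  rewrite exprMn sqr_sqrtr; last exact: ltW.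
  move: (window R n 1 ^+ 2) W (sqr_ge0 (window R n 1)) => w W w20.
  have : w * (3 * n%:R) <= 4 by nra.
  lra.
rewrite ler_pdivlMr// -mulrA.
have w0 := window_ge0 R n 1.
have : 0 <= window R n 1 * Num.sqrt n%:R by rewrite mulr_ge0// ltW.
move: (_ * Num.sqrt _) wn => w wn ww0.
(* As y = u^2 + 1, the claim is u^2 - 7/2 u + 10/3 >= 0; completing the square leaves 10/3 - 49/16 >
   0. *)
apply: (@le_trans _ _ ((3 * u - 2) * (7 / 6))); last first.
  by have := sqr_ge0 (u - 7 / 4); rewrite sqrrB u2; lra.
by apply: ler_pM => //.
Qed.

End anticoncentration.

(** * Probability integral transform and partial quantile indices *)

Section null_sets.
Context (R : realType) d (T : measurableType d) (P : probability T R).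

Lemma le_measure_null (A B N : set T) :
  measurable A -> measurable B -> measurable N -> P N = 0%E ->
  A `<=` B `|` N -> (P A <= P B)%E.
Proof.
move=> mA mB mN N0 AB; rewrite -[leRHS]adde0 -N0.
apply: le_trans (measureU2 _ mB mN).
by apply: le_measure; rewrite ?inE//; exact: measurableU.
Qed.

Lemma eq_measure_null (A B N : set T) :
  measurable A -> measurable B -> measurable N -> P N = 0%E ->
  (forall t, ~ N t -> A t <-> B t) -> P A = P B.
Proof.
move=> mA mB mN N0 AB; apply/eqP; rewrite eq_le; apply/andP; split;
  apply: (le_measure_null _ _ mN N0) => // t tA;
  by have [?|/AB[? ?]] := pselect (N t); [right|left; auto].
Qed.

End null_sets.

Section probability_integral_transform.
Context (R : realType) d (T : measurableType d) (P : probability T R)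
  (X : {RV P >-> R}).
Hypothesis X_atomless : forall a, P (X @^-1` [set a]) = 0%E.

Definition rcdf (x : R) : R := fine (cdf X x).

Lemma rcdfE x : cdf X x = (rcdf x)%:E.
Proof. by rewrite fineK// fin_num_measure. Qed.

Lemma rcdf_ge0 x : 0 <= rcdf x.
Proof. by rewrite fine_ge0// cdf_ge0. Qed.

Lemma rcdf_le1 x : rcdf x <= 1.
Proof. by rewrite -lee_fin -rcdfE cdf_le1. Qed.

Lemma rcdf_mono : {homo rcdf : x y / x <= y}.
Proof. by move=> x y xy; rewrite -lee_fin -!rcdfE; exact: cdf_nondecreasing. Qed.

Lemma measurable_rcdf : measurable_fun setT rcdf.
Proof.
apply/measurable_EFinP.
by apply: eq_measurable_fun (cdf_measurable X) => x _ /=; rewrite rcdfE.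
Qed.

(** Take a to be the supremum of the points where F <= u. Right continuity gives F a >= u, and the
    absence of an atom at a gives F a <= u. Being the largest such point, a turns the event F (X) <=
    u into X <= a even where F is flat. *)
Lemma rcdf_quantile u : 0 < u < 1 ->
  exists a, rcdf a = u /\ forall x, rcdf x <= u -> x <= a.
Proof.
move=> /andP[u0 u1]; pose E := [set x | rcdf x <= u].
have FNy : rcdf x @[x --> -oo] --> 0.
  by apply: fine_cvg; exact: cvg_cdfNy0.
have Fy : rcdf x @[x --> +oo] --> (1 : R).
  by apply: fine_cvg; exact: cvg_cdfy1.
have E0 : E !=set0.
  near (-oo : set_system R) => x; exists x; apply: ltW.
  by near: x; exact: (cvgr_lt _ FNy).
have Eub : has_ubound E.
  near (+oo : set_system R) => y.
  have uy : u < rcdf y by near: y; exact: (cvgr_gt _ Fy).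
  exists y => x /= xu; rewrite leNgt; apply/negP => /ltW/rcdf_mono yx.
  by have := lt_le_trans uy (le_trans yx xu); rewrite ltxx.
have hE : has_sup E by [].
have Ele x : rcdf x <= u -> x <= sup E by move=> xu; exact: sup_upper_bound.
have lt_le x : x < sup E -> rcdf x <= u.
  by move=> /(sup_gt E0)[y Ey /ltW/rcdf_mono xy]; exact: le_trans xy Ey.
exists (sup E); split => //; set a := sup E.
apply/eqP; rewrite eq_le; apply/andP; split; last first.
  rewrite leNgt; apply/negP => aF.
  have Fa : rcdf x @[x --> a^'+] --> rcdf a.
    by apply: fine_cvg; rewrite -rcdfE; exact: cdf_right_continuous.
  near a^'+ => y.
  have ay : a < y by near: y; exact: nbhs_right_gt.
  have /ltW/Ele : rcdf y < u by near: y; exact: (cvgr_lt _ Fa).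
  by rewrite leNgt ay.
pose An n := X @^-1` `]-oo, a - n.+1%:R^-1].
have mAn n : measurable (An n) by exact: measurable_funPTI.
have AE : \bigcup_n An n = X @^-1` `]-oo, a[.
  apply/seteqP; split => t; rewrite /An /preimage/= in_itv/=.
    move=> [n _ /=]; rewrite in_itv/= => /le_lt_trans; apply.
    by rewrite ltrBlDr ltrDl.
  move=> /ltr_add_invr[k Xk]; exists k => //=; rewrite in_itv/=.
  by rewrite lerBrDr ltW.
have An_cvg : P (An n) @[n --> \oo] --> P (X @^-1` `]-oo, a[).
  rewrite -AE; apply: nondecreasing_cvg_mu => //; first exact: bigcup_measurable.
  move=> n k nk; apply/subsetPset => t; rewrite /An /preimage/= !in_itv/=.
  by move=> /le_trans; apply; rewrite lerD2l lerN2 lef_pV2 ?posrE// ler_nat.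
have : (P (X @^-1` `]-oo, a[) <= u%:E)%E.
  rewrite -(cvg_lim _ An_cvg)//; apply: lime_le; first by apply/cvg_ex; eexists; exact: An_cvg.
  apply: nearW => n; rewrite -[leLHS]/(cdf X _) rcdfE lee_fin; apply: lt_le.
  by rewrite ltrBlDr ltrDl.
rewrite -lee_fin -rcdfE; apply: le_trans.
apply: (le_measure_null _ _ (measurable_funPTI X (measurable_set1 a)) (X_atomless a)).
- exact: measurable_funPTI.
- exact: measurable_funPTI.
- move=> t; rewrite /preimage/= !in_itv/= le_eqVlt => /predU1P[->|Xa]; [by right|by left].
Unshelve. all: end_near. Qed.

Lemma pit u : 0 < u < 1 -> P [set t | rcdf (X t) <= u] = u%:E.
Proof.
move=> /rcdf_quantile[a [<- ale]]; rewrite -rcdfE /cdf /distribution /pushforward.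
congr (P _); apply/seteqP; split => t; rewrite /preimage/= in_itv/=; first exact: ale.
exact: rcdf_mono.
Qed.

End probability_integral_transform.

Section log_odds.
Context (R : realType) d (T : measurableType d) (P : probability T R)
  (X : {RV P >-> R}).
Hypothesis X_atomless : forall a, P (X @^-1` [set a]) = 0%E.

Let F := rcdf X.

Definition log_odds (x : R) : R := ln (F x) - ln (1 - F x).

Lemma measurable_log_odds : measurable_fun setT log_odds.
Proof.
apply: measurable_funB; apply: (measurableT_comp (@measurable_ln R)).
  exact: measurable_rcdf.
apply: measurable_funB => //; exact: measurable_rcdf.
Qed.

Definition log_odds_rv : {RV P >-> R} :=
  mfun_Sub (mem_set (measurableT_comp measurable_log_odds (measurable_funPT X))).

(** Here one of the two logarithms in [log_odds] takes its default value, so the log-odds lose their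
    meaning. *)
Definition degenerate := [set t | ~~ (0 < F (X t) < 1)].

Let mFX : measurable_fun setT (F \o X).
Proof. exact: measurableT_comp (@measurable_rcdf _ _ _ _ _) (measurable_funPT X). Qed.

Let mFle u : measurable [set t | F (X t) <= u].
Proof.
rewrite -[X in measurable X]setTI.
have -> : [set t | F (X t) <= u] = (F \o X) @^-1` `]-oo, u].
  by apply/seteqP; split => t; rewrite /= in_itv.
exact: mFX.
Qed.

Let mFlt u : measurable [set t | F (X t) < u].
Proof.
rewrite -[X in measurable X]setTI.
have -> : [set t | F (X t) < u] = (F \o X) @^-1` `]-oo, u[.
  by apply/seteqP; split => t; rewrite /= in_itv.
exact: mFX.
Qed.

Let pitF u : 0 < u < 1 -> P [set t | F (X t) <= u] = u%:E.
Proof. exact: pit. Qed.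

Lemma measurable_degenerate : measurable degenerate.
Proof.
have -> : degenerate = [set t | F (X t) <= 0] `|` ~` [set t | F (X t) < 1].
  apply/seteqP; split => t; rewrite /degenerate/= negb_and -leNgt.
    by move=> /orP[|/negP]; [left|right].
  by move=> [->//|/negP ->]; rewrite orbT.
by apply: measurableU => //; exact: measurableC.
Qed.

Lemma degenerate_null : P degenerate = 0%E.
Proof.
apply/eqP; rewrite eq_le measure_ge0 andbT.
apply/lee_addgt0Pr => e e0; rewrite add0e.
(* [pit] covers only 0 < u < 1, so the values 0 and 1 are approached through e' and 1 - e'; the cap
   1/2 keeps both inside. *)
pose e' := Num.min (e / 2) 2^-1.
have e'0 : 0 < e' by rewrite lt_min divr_gt0//=.
have e'1 : e' <= 2^-1 by rewrite ge_min lexx orbT.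
have e'e : e' <= e / 2 by rewrite ge_min lexx.
have -> : e%:E = (e / 2 + e / 2)%:E by congr EFin; lra.
apply: (@le_trans _ _ (P ([set t | F (X t) <= e'] `|` ~` [set t | F (X t) <= 1 - e']))).
  apply: le_measure; rewrite ?inE//; first exact: measurable_degenerate.
    by apply: measurableU => //; exact: measurableC.
  move=> t; rewrite /degenerate/= negb_and -!leNgt => /orP[h|h]; [left; lra|right].
  by apply/negP; rewrite -ltNge; lra.
apply: (le_trans (measureU2 _ _ _)) => //; first exact: measurableC.
rewrite EFinD; apply: leeD.
  by rewrite [leLHS]pitF ?lee_fin//; apply/andP; split; lra.
rewrite [leLHS]probability_setC// [X in (_ - X)%E]pitF ?lee_fin; last by apply/andP; split; lra.
by lra.
Qed.

(** Off the degenerate event, log-odds at most x means F (X) <= logistic x, and F (X) is uniform. *)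
Lemma log_odds_rv_cdf x : cdf log_odds_rv x = (logistic x)%:E.
Proof.
rewrite -pitF; last by rewrite logistic_gt0 logistic_lt1.
apply: (eq_measure_null _ _ measurable_degenerate degenerate_null) => //.
  exact: measurable_funPTI.
move=> t /negP; rewrite negbK => /andP[F0 F1].
rewrite /preimage/= in_itv/= /log_odds.
rewrite -[_ - _ <= x]logistic_mono logistic_lnB ?subr_gt0//.
by rewrite addrC subrK divr1.
Qed.

End log_odds.

(** * Closed form of the partial quantile index *)

Section partial_quantile_index_formula.
Context (R : realType) disp (T : measurableType disp) (P : probability T R)
  (d : nat) (X : {RV P >-> d.-tuple R}).

Definition coord (j : 'I_d) : {RV P >-> R} :=
  mfun_Sub (mem_set (measurableT_comp (measurable_tnth j) (measurable_funPT X))).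

Hypothesis d_gt0 : (0 < d)%N.
Hypothesis X_atomless : forall j a, P (coord j @^-1` [set a]) = 0%E.
Hypothesis X_indep : independent_family P (fun j t => coord j t).

Let below (x : d.-tuple R) := \prod_(j < d) rcdf (coord j) (tnth x j).
Let above (x : d.-tuple R) := \prod_(j < d) (1 - rcdf (coord j) (tnth x j)).

Let indepT (A : 'I_d -> set R) : (forall j, measurable (A j)) ->
  P [set t | forall j, A j (coord j t)] = (\prod_(j < d) P (coord j @^-1` A j))%E.
Proof.
move=> mA; transitivity (\prod_(j in [set: 'I_d]%SET) P (coord j @^-1` A j))%E; last first.
  by apply: eq_bigl => j; rewrite inE.
rewrite -(X_indep [set: 'I_d]%SET mA); congr (P _).
apply/seteqP; split => t /= tA j; first by move=> _; exact: tA.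
by apply: tA; rewrite /= inE.
Qed.

Let measurableT_all (A : 'I_d -> set R) : (forall j, measurable (A j)) ->
  measurable [set t | forall j, A j (coord j t)].
Proof.
move=> mA; have -> : [set t | forall j, A j (coord j t)] =
    \bigcap_(j in setT) (coord j @^-1` A j).
  by apply/seteqP; split => t /= tA j; [move=> _|]; apply: tA.
apply: fin_bigcap_measurable; first exact: finite_finset.
by move=> j _; exact: measurable_funPTI.
Qed.

Let P_below x : P [set t | succeq x (X t)] = (below x)%:E.
Proof.
have := @indepT (fun j => `]-oo, tnth x j]%classic) (fun j => measurable_itv _).
rewrite /below -prodEFin => E.
transitivity (P [set t | forall j, coord j t \in `]-oo, tnth x j]]).
  by congr (P _); apply/seteqP; split => t /= tx j; have := tx j; rewrite /= in_itv.
by rewrite [LHS]E; apply: eq_bigr => j _; rewrite -rcdfE.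
Qed.

Let P_above x : P [set t | succeq (X t) x] = (above x)%:E.
Proof.
have := @indepT (fun j => `[tnth x j, +oo[%classic) (fun j => measurable_itv _).
rewrite /above -prodEFin => E.
transitivity (\prod_(j < d) P (coord j @^-1` `[tnth x j, +oo[))%E; last first.
  apply: eq_bigr => j _; rewrite EFinB -rcdfE -ccdf_1_cdf.
  rewrite /ccdf /distribution /pushforward.
  have m1 : measurable (coord j @^-1` [set tnth x j]) by exact: measurable_funPTI.
  apply: (eq_measure_null _ _ m1 (X_atomless j _)).
  - exact: measurable_funPTI.
  - exact: measurable_funPTI.
  - move=> t /eqP xt; rewrite /preimage/= !in_itv/= !andbT lt_neqAle.
    by rewrite eq_sym xt.
rewrite -E.
by congr (P _); apply/seteqP; split => t /= tx j; have := tx j; rewrite /= in_itv/= andbT.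
Qed.

(** Independence factors the masses of both orthants at x. They meet within the event that the first
    coordinate of X equals that of x, which is null; a first coordinate exists because d > 0. If
    both orthants are null, both sides are 0 / 0 = 0. *)
Lemma partial_quantile_indexE x :
  partial_quantile_index X x = below x / (below x + above x).
Proof.
have mB : measurable [set t | succeq x (X t)].
  rewrite (_ : [set t | _] = [set t | forall j, `]-oo, tnth x j]%classic (coord j t)]).
    exact: (@measurableT_all (fun j => `]-oo, tnth x j]%classic) (fun j => measurable_itv _)).
  by apply/seteqP; split => t /= tx j; have := tx j; rewrite /= in_itv.
have mA : measurable [set t | succeq (X t) x].
  rewrite (_ : [set t | _] = [set t | forall j, `[tnth x j, +oo[%classic (coord j t)]).
    exact: (@measurableT_all (fun j => `[tnth x j, +oo[%classic) (fun j => measurable_itv _)).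
  by apply/seteqP; split => t /= tx j; have := tx j; rewrite /= in_itv/= andbT.
have E0 : P ([set t | succeq (X t) x] `&` [set t | succeq x (X t)]) = 0%E.
  apply/eqP; rewrite eq_le measure_ge0 andbT.
  rewrite -(X_atomless (Ordinal d_gt0) (tnth x (Ordinal d_gt0))).
  apply: le_measure; rewrite ?inE//; first exact: measurableI.
  move=> t [/= t1 t2]; rewrite /preimage/=.
  by apply/eqP; rewrite eq_le t1 t2.
rewrite /partial_quantile_index /cond_prob.
have -> : X @^-1` comparable_set x =
    [set t | succeq (X t) x] `|` [set t | succeq x (X t)] by [].
rewrite setIUr setIid (setUidr (@subIsetl _ _ _)).
rewrite P_below; congr (_ / _).
have -> : P ([set t | succeq (X t) x] `|` [set t | succeq x (X t)]) =
    (P [set t | succeq (X t) x] + P [set t | succeq x (X t)])%E.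
  rewrite [LHS]measureUfinr//; first by rewrite [X in (_ - X)%E]E0 sube0.
  by rewrite (le_lt_trans (probability_le1 _ _)) ?ltry.
by rewrite P_above P_below addrC.
Qed.

End partial_quantile_index_formula.

Lemma size_index_enum_ord d : size (index_enum 'I_d) = d.
Proof.
rewrite -(card_uniqP (index_enum_uniq _)) -[RHS]card_ord.
by apply: eq_card => j; rewrite mem_index_enum.
Qed.

Section partial_quantile_index_law.
Context (R : realType) disp (T : measurableType disp) (P : probability T R)
  (d : nat) (X : {RV P >-> d.-tuple R}).
Hypothesis d_gt0 : (0 < d)%N.
Hypothesis X_atomless : forall j a, P (coord X j @^-1` [set a]) = 0%E.
Hypothesis X_indep : independent_family P (fun j t => coord X j t).

Let W (j : 'I_d) : {RV P >-> R} := log_odds_rv (coord X j).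
Let S : {RV P >-> R} := rv_sum W (index_enum 'I_d).
Let tau t := partial_quantile_index X (X t).
Let N := \bigcup_(j in [set: 'I_d]) degenerate (coord X j).

Lemma log_odds_independent : independent_family P (fun j t => W j t).
Proof.
move=> J A mA.
apply: (X_indep J (A := fun j => log_odds (coord X j) @^-1` A j)) => j.
by rewrite -[X in measurable X]setTI; apply: measurable_log_odds.
Qed.

Lemma log_odds_cdf j x : cdf (W j) x = (logistic x)%:E.
Proof. exact: (log_odds_rv_cdf (X_atomless j)). Qed.

Let mN : measurable N.
Proof.
apply: fin_bigcup_measurable; first exact: finite_finset.
by move=> j _; exact: measurable_degenerate.
Qed.

Let N0 : P N = 0%E.
Proof.
have -> : N = \big[setU/set0]_(j < d) degenerate (coord X j).
  by rewrite -bigcup_seq; apply: eq_bigcupl => //; split => j //= _; exact: mem_index_enum.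
suff [] : measurable (\big[setU/set0]_(j < d) degenerate (coord X j)) /\
    P (\big[setU/set0]_(j < d) degenerate (coord X j)) = 0%E by [].
elim/big_ind: _ => [|A B [mA A0] [mB B0]|j _]; first by rewrite measure0.
  split; first exact: measurableU.
  apply/eqP; rewrite eq_le measure_ge0 andbT.
  by apply: le_trans (measureU2 _ mA mB) _; rewrite [X in (X + _)%E]A0 [X in (_ + X)%E]B0 adde0.
split; first exact: measurable_degenerate.
exact: (degenerate_null (X_atomless j)).
Qed.

Let tauE t : ~ N t -> tau t = logistic (S t).
Proof.
move=> Nt; have F01 j : 0 < rcdf (coord X j) (coord X j t) < 1.
  by apply: contrapT => /negP Fj; apply: Nt; exists j.
have ln_prod (f : 'I_d -> R) : (forall j, 0 < f j) ->
    ln (\prod_(j < d) f j) = \sum_(j < d) ln (f j).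
  move=> f0; suff [] : 0 < \prod_(j < d) f j /\
      ln (\prod_(j < d) f j) = \sum_(j < d) ln (f j) by [].
  elim/big_ind2: _ => [|x1 x2 y1 y2 [x0 <-] [y0 <-]|j _] //; first by rewrite ltr01 ln1.
  by rewrite mulr_gt0// lnM.
rewrite /tau partial_quantile_indexE// -logistic_lnB; last 2 first.
- by apply: prodr_gt0 => j _; have /andP[] := F01 j.
- by apply: prodr_gt0 => j _; rewrite subr_gt0; have /andP[] := F01 j.
rewrite !ln_prod; last 2 first.
- by move=> j; rewrite subr_gt0; have /andP[] := F01 j.
- by move=> j; have /andP[] := F01 j.
by rewrite -sumrB /S rv_sumE.
Qed.

Let measurable_tau : measurable_fun setT tau.
Proof.
pose A t := \prod_(j < d) rcdf (coord X j) (tnth (X t) j).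
pose B t := \prod_(j < d) (1 - rcdf (coord X j) (tnth (X t) j)).
have mc j : measurable_fun setT (fun t => rcdf (coord X j) (tnth (X t) j)).
  exact: measurableT_comp (@measurable_rcdf _ _ _ _ _) (measurable_funPT (coord X j)).
have mA : measurable_fun setT A by apply: measurable_prod => j _.
have mB : measurable_fun setT B.
  by apply: measurable_prod => j _; exact: measurable_funB.
have A0 t : 0 <= A t by apply: prodr_ge0 => j _; exact: rcdf_ge0.
have B0 t : 0 <= B t by apply: prodr_ge0 => j _; rewrite subr_ge0 rcdf_le1.
(* The inverse is written as an exponential of a logarithm, a composition of measurable maps; where
   A + B is 0, so is A, and the other factor does not matter. *)
have -> : tau = (fun t => A t * expR (- ln (A t + B t))).
  apply/funext => t; rewrite /tau partial_quantile_indexE// -/(A t) -/(B t).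
  have [AB|] := ltP 0 (A t + B t); first by rewrite expRN lnK.
  move=> AB; have -> : A t = 0 by have := A0 t; have := B0 t; lra.
  by rewrite !mul0r.
apply: measurable_funM => //; apply: measurableT_comp => //.
by apply: measurableT_comp => //; apply: measurableT_comp => //; exact: measurable_funD.
Qed.

(** Stated for an arbitrary interval to serve all three claims, with a left ray, a right ray and a
    central interval. *)
Lemma tau_law (I : interval R) (B : set R) : measurable B ->
  (forall x, (logistic x \in I) <-> B x) ->
  P [set t | partial_quantile_index X (X t) \in I] = distribution P S B.
Proof.
move=> mB IB; apply: (eq_measure_null _ _ mN N0).
- rewrite -[X in measurable X]setTI; apply: (measurable_tau _ (measurable_itv I)) => //.
- exact: measurable_funPTI.
- by move=> t Nt; rewrite /= -/(tau t) (tauE Nt); exact: IB.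
Qed.

Lemma log_odds_sum_atomless x : P (S @^-1` [set x]) = 0%E.
Proof.
have : uniq (index_enum 'I_d) by exact: index_enum_uniq.
have : (0 < size (index_enum 'I_d))%N by rewrite size_index_enum_ord.
rewrite /S; case: (index_enum _) => // j s _ us.
have Wj y : P (W j @^-1` [set y]) = 0%E by exact: (logistic_atomless (log_odds_cdf j)).
exact: (@distribution_sum_atomless _ _ _ _ _ W log_odds_independent _ _ x us Wj).
Qed.

(** The opposites of the log-odds form an independent family with the same marginals, so S is
    symmetric; as 0 is not an atom, both closed half-lines have mass 1/2. *)
Lemma log_odds_sum_ge0 : distribution P S `[0, +oo[ = (2^-1)%:E.
Proof.
have SN : distribution P S `[0, +oo[ = distribution P S `]-oo, 0].
  have <- : distribution P (rv_sum (fun j => rv_opp (W j)) (index_enum 'I_d))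
      `]-oo, 0%R] = distribution P S `]-oo, 0].
    apply: distribution_sum_ext => //.
    - exact: independent_opp log_odds_independent.
    - exact: log_odds_independent.
    - by move=> j; apply: cdf_opp_logistic; exact: log_odds_cdf.
    - exact: index_enum_uniq.
  have E t : rv_sum (fun j => rv_opp (W j)) (index_enum 'I_d) t = - S t.
    by rewrite /S !rv_sumE -sumrN.
  rewrite /distribution /pushforward; congr (P _); apply/seteqP; split => t;
    by rewrite /preimage/= !in_itv/= andbT E oppr_le0.
have : (distribution P S `]-oo, 0%R] + distribution P S `]0%R, +oo[ = 1)%E.
  exact: cdf_ccdf_1.
have -> : distribution P S `]0, +oo[ = distribution P S `[0, +oo[.
  have S0 : distribution P S [set 0] = 0%E := log_odds_sum_atomless 0.
  apply: (@eq_measure_null _ _ _ (distribution P S) _ _ _ _ _ (measurable_set1 0) S0) => //.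
  by move=> x /eqP x0; rewrite /= !in_itv/= !andbT lt_neqAle eq_sym x0.
rewrite SN; set p := distribution _ _ _.
have pfin : p \is a fin_num by rewrite fin_num_measure.
rewrite -(fineK pfin) -EFinD => -[h]; congr EFin; lra.
Qed.

End partial_quantile_index_law.

Theorem theorem9 (R : realType) (disp : measure_display)
  (T : measurableType disp) (P : probability T R)
  (d : nat) (d_gt0 : (0 < d)%N) (X : {RV P >-> d.-tuple R})
  (X_no_point_mass : forall (j : 'I_d) (a : R),
     P [set t | tnth (X t) j = a] = 0%E)
  (X_indep : independent_family P (fun (j : 'I_d) t => tnth (X t) j)) :
  [/\ forall (disp' : measure_display) (T' : measurableType disp')
        (Q : probability T' R) (Z : 'I_d -> {RV Q >-> R}),
        independent_family Q (fun (j : 'I_d) w => Z j w) ->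
        (forall j, logistic_rv (Z j)) ->
        (forall j, ('E_Q[Z j])%E = 0%E) ->
        (forall j, ('V_Q[Z j])%E = (pi ^+ 2 / 3)%:E) ->
        forall tau : R, 0 < tau < 1 ->
          P [set t | partial_quantile_index X (X t) <= tau] =
          Q [set w | \sum_(j < d) Z j w <= ln (tau / (1 - tau))],
      P [set t | 1 / 2 <= partial_quantile_index X (X t)] = (1 / 2)%:E
    & forall C : R, 0 < C ->
        (P [set t | (`|partial_quantile_index X (X t) - 1 / 2|
                     <= 1 / 2 - C * d%:R `^ (- (1 / 2)))%R]
         <= (1 / C)%:E)%E].
Proof.
have X0 j a : P (coord X j @^-1` [set a]) = 0%E by exact: X_no_point_mass.
have Xi : independent_family P (fun j t => coord X j t) by exact: X_indep.
have law := tau_law d_gt0 X0 Xi.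
have Wi := log_odds_independent Xi.
have Wcdf := log_odds_cdf X0.
set S := rv_sum _ _ in law.
have Iu : uniq (index_enum 'I_d) by exact: index_enum_uniq.
split.
- move=> disp' T' Q Z Zi Zl EZ VZ tau /andP[tau0 tau1].
  have Zcdf j x : cdf (Z j) x = (logistic x)%:E by exact: logistic_rv_cdf.
  have -> : [set w | \sum_(j < d) Z j w <= ln (tau / (1 - tau))] =
      rv_sum Z (index_enum 'I_d) @^-1` `]-oo, ln (tau / (1 - tau))].
    by apply/seteqP; split => w; rewrite /preimage/= in_itv/= rv_sumE.
  transitivity (distribution P S `]-oo, ln (tau / (1 - tau))]).
    rewrite -(law `]-oo, tau]) //; last first.
      move=> x; rewrite /= !in_itv/= -[in X in _ <-> X]logistic_mono ln_div ?posrE ?subr_gt0//.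
      by rewrite logistic_lnB ?subr_gt0// addrC subrK divr1.
  apply: distribution_sum_ext => //.
  by move=> j x; rewrite Wcdf Zcdf.
- rewrite [RHS](_ : _ = (2^-1)%:E); last by rewrite div1r.
  rewrite -(log_odds_sum_ge0 d_gt0 X0 Xi) -/S -(law `[(1 / 2), +oo[) //.
    by congr (P _); apply/seteqP; split => t; rewrite /= in_itv/= andbT.
  move=> x; rewrite /= !in_itv/= !andbT -[in X in _ <-> X]logistic_mono.
  by rewrite /logistic oppr0 expR0 div1r.
- move=> C C0.
  set c := C * d%:R `^ (- (1 / 2)).
  have d0 : 0 < d%:R :> R by rewrite ltr0n.
  have cE : c = C / Num.sqrt d%:R.
    by rewrite /c powRN div1r powR12_sqrt// ltW.
  have sd0 : 0 < Num.sqrt d%:R :> R by rewrite sqrtr_gt0.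
  have c0 : 0 < c by rewrite cE divr_gt0.
  (* For c > 1/2 the bound on the modulus is negative and the event is empty; otherwise 1/c >= 2, as
     [anticoncentration] requires. *)
  have [c2|c2] := ltP (1 / 2) c.
    rewrite (_ : [set t | _] = set0); first by rewrite measure0 lee_fin divr_ge0// ltW.
    apply/seteqP; split => // t /= h.
    have := normr_ge0 (partial_quantile_index X (X t) - 1 / 2); lra.
  have c12 : 0 < c < 1 by apply/andP; split => //; lra.
  pose L := ln (c^-1 - 1).
  have odds : c^-1 - 1 = (1 - c) / c by field; rewrite gt_eqF.
  have lL : logistic L = 1 - c.
    rewrite /L odds ln_div ?posrE ?subr_gt0//; last lra.
    rewrite logistic_lnB ?subr_gt0//; last lra.
    by rewrite subrK divr1.
  have lNL : logistic (- L) = c by rewrite logisticN lL; lra.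
  (* The index lies in [c, 1 - c] when |S| <= L, so [anticoncentration] is used at y = 1/c, where
     its bound y / sqrt d is 1 / C. *)
  have -> : (1 / C)%:E = (c^-1 / Num.sqrt d%:R)%:E.
    by congr EFin; rewrite cE; field; rewrite !gt_eqF.
  have anti := anticoncentration Wi Wcdf (s := index_enum 'I_d) (y := c^-1) Iu.
  rewrite size_index_enum_ord in anti.
  have y2 : 2 <= c^-1.
    by rewrite -[2]invrK lef_pV2 ?posrE//; lra.
  apply: le_trans (anti d_gt0 y2).
  rewrite -/L -/S -(law `[c, (1 - c)]) //.
    rewrite le_eqVlt; apply/orP; left; apply/eqP; congr (P _).
    apply/seteqP; split => t; rewrite /= in_itv/= ler_norml.
      by move=> /andP[h1 h2]; apply/andP; split; lra.
    by move=> /andP[h1 h2]; apply/andP; split; lra.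
  by move=> x; rewrite /= !in_itv/= -{1}lNL -lL !logistic_mono.
Qed.
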